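(* Let $T$ be a power bounded operator on a complex Banach space, let $w\in A^{1,1}(\mathbb D)$, and suppose that $$\sup_{n\ge1}\|w(T^n)\|\le q<\|w\|_\infty .$$ Define $$E=E(w,q):=\Big\{\lambda\in\mathbb T:\ \sup_{n\ge1}|w(\lambda^n)|\le q\Big\}.$$ Then $E$ is a finite set of roots of unity and $\sigma(T)\cap\mathbb T\subset E$. More precisely: (i) If $E=\emptyset$, then $r(T)<1$. (ii) If $E\ne\emptyset$, then $1\in E$. If $N$ is the least common multiple of the orders of the elements of $E$, then $T^N$ is a Ritt operator and $T$ is a $\mathrm{Ritt}_E$ operator.
   Context: $\mathbb D$ is the open unit disc, $\mathbb T$ the unit circle, $r(T)$ the spectral radius. $T$ is power bounded if $\sup_{n\ge0}\|T^n\|<\infty$. $A^{1,1}(\mathbb D)$ is the algebra of functions $w(z)=\sum_{k\ge0}c_kz^k$ with $\sum_k(k+1)|c_k|<\infty$; $\|w\|_\infty:=\max_{\mathbb T}|w|$; for power bounded $S$, $w(S):=\sum_{k\ge0}c_kS^k$. $T$ is a Ritt operator if $\sigma(T)\subset\overline{\mathbb D}$ and $\sup_{|\lambda|>1}|\lambda-1|\,\|(\lambda-T)^{-1}\|<\infty$; for a finite nonempty $E\subset\mathbb T$, $T$ is a $\mathrm{Ritt}_E$ operator if $\sigma(T)\subset\overline{\mathbb D}$ and $\sup_{|\lambda|>1}\operatorname{dist}(\lambda,E)\,\|(\lambda-T)^{-1}\|<\infty$. *)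

(* Defs.v *)
(* Stdlib reals with Coquelicot: a complex Banach space is a
   [CompleteNormedModule C_AbsRing], and a bounded operator on it is a function
   satisfying Coquelicot's [is_linear] (which includes boundedness). *)
From Stdlib Require Import Reals Lra Lia List ClassicalEpsilon.
From Coquelicot Require Import Coquelicot.
Open Scope R_scope.

Definition unit_circle (z : C) : Prop := Cmod z = 1.

Section Operators.
Context {X : NormedModule C_AbsRing}.

(* Meaningful for bounded [A] only: an infinite supremum has real part 0. *)
Definition op_norm (A : X -> X) : R :=
  real (Lub_Rbar (fun r => exists x : X, norm x <= 1 /\ r = norm (A x))).

Definition op_pow (A : X -> X) (n : nat) : X -> X := Nat.iter n A.

Definition power_bounded (A : X -> X) : Prop :=
  exists M : R, forall n : nat, op_norm (op_pow A n) <= M.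

(* [B] is the bounded inverse of [z - A]. *)
Definition is_resolvent (A : X -> X) (z : C) (B : X -> X) : Prop :=
  is_linear B /\
  (forall x : X, B (minus (scal z x) (A x)) = x) /\
  (forall x : X, minus (scal z (B x)) (A (B x)) = x).

Definition spectrum (A : X -> X) (z : C) : Prop :=
  ~ exists B : X -> X, is_resolvent A z B.

(* The supremum is [m_infty], with real part 0, when the spectrum is empty;
   for a bounded operator this happens only on the zero space. *)
Definition spectral_radius (A : X -> X) : R :=
  real (Lub_Rbar (fun r => exists z : C, spectrum A z /\ r = Cmod z)).

Definition is_Ritt (A : X -> X) : Prop :=
  (forall z : C, spectrum A z -> Cmod z <= 1) /\
  exists K : R, forall (z : C) (B : X -> X),
    1 < Cmod z -> is_resolvent A z B -> Cmod (z - 1)%C * op_norm B <= K.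

End Operators.

Definition finite_set (E : C -> Prop) : Prop :=
  exists l : list C, forall z : C, E z <-> In z l.

Definition dist_set (z : C) (E : C -> Prop) : R :=
  real (Glb_Rbar (fun r => exists u : C, E u /\ r = Cmod (z - u)%C)).

Definition is_Ritt_on {X : NormedModule C_AbsRing}
    (E : C -> Prop) (A : X -> X) : Prop :=
  finite_set E /\ (exists u : C, E u) /\
  (forall u : C, E u -> unit_circle u) /\
  (forall z : C, spectrum A z -> Cmod z <= 1) /\
  exists K : R, forall (z : C) (B : X -> X),
    1 < Cmod z -> is_resolvent A z B -> dist_set z E * op_norm B <= K.

(* An element of the algebra is given by its Taylor coefficients. *)
Record A11 := {
  coef :> nat -> C;
  coef_summable : ex_series (fun k : nat => INR (k + 1) * Cmod (coef k))
}.

Definition A11_eval (w : A11) (z : C) : C :=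
  iota (T := C_CompleteNormedModule)
    (is_series (V := C_CompleteNormedModule) (fun k : nat => w k * z ^ k)%C).

Definition A11_norm_infty (w : A11) : R :=
  real (Lub_Rbar (fun r =>
    exists z : C, unit_circle z /\ r = Cmod (A11_eval w z))).

Definition is_op_series {X : NormedModule C_AbsRing}
    (c : nat -> C) (S W : X -> X) : Prop :=
  is_linear W /\
  is_lim_seq (fun n : nat => op_norm (fun x : X =>
    minus (sum_n (fun k : nat => scal (c k) (op_pow S k x)) n) (W x))) 0.

(* The operator-norm sum of [w k * S ^ k]; it exists whenever [S] is power
   bounded, see [A11_op_correct]. *)
Definition A11_op {X : NormedModule C_AbsRing}
    (w : A11) (S : X -> X) : X -> X :=
  epsilon (inhabits (fun x : X => x)) (is_op_series w S).

Definition E_set (w : A11) (q : R) (z : C) : Prop :=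
  unit_circle z /\
  forall n : nat, (1 <= n)%nat -> Cmod (A11_eval w (z ^ n)%C) <= q.

Definition is_order (z : C) (m : nat) : Prop :=
  (1 <= m)%nat /\ (z ^ m)%C = 1%C /\
  forall k : nat, (1 <= k < m)%nat -> (z ^ k)%C <> 1%C.

Definition root_of_unity (z : C) : Prop :=
  exists m : nat, (1 <= m)%nat /\ (z ^ m)%C = 1%C.

(* Least positive common multiple of the elements of [P]. *)
Definition is_lcm (P : nat -> Prop) (N : nat) : Prop :=
  (1 <= N)%nat /\ (forall m : nat, P m -> Nat.divide m N) /\
  forall M : nat, (1 <= M)%nat -> (forall m : nat, P m -> Nat.divide m M) ->
    (N <= M)%nat.

Lemma minus_plus_plus {G : AbelianGroup} (a b c d : G) :
  minus (plus a b) (plus c d) = plus (minus a c) (minus b d).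
Proof.
unfold minus. rewrite opp_plus, <- !plus_assoc. apply f_equal.
rewrite !plus_assoc. apply (f_equal (fun z => plus z _)), plus_comm.
Qed.

Lemma minus_plus_r {G : AbelianGroup} (a b c : G) :
  minus a (plus b c) = plus (minus a b) (opp c).
Proof. unfold minus. now rewrite opp_plus, plus_assoc. Qed.

Lemma minus_minus_cancel {G : AbelianGroup} (a b : G) :
  minus a (minus a b) = b.
Proof.
unfold minus at 1. rewrite opp_minus. unfold minus.
rewrite plus_comm, <- plus_assoc, plus_opp_l. apply plus_zero_r.
Qed.

Lemma scal_minus_distr_l {K : Ring} {V : ModuleSpace K} (a : K) (u v : V) :
  scal a (minus u v) = minus (scal a u) (scal a v).
Proof.
unfold minus. rewrite <- scal_opp_r. exact (scal_distr_l a u (opp v)).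
Qed.

Section Facts.
Context {X : NormedModule C_AbsRing}.

Lemma norm_scal_C (c : C) (x : X) : norm (scal c x) = Cmod c * norm x.
Proof.
apply Rle_antisym; [exact (norm_scal c x)|].
destruct (Ceq_dec c 0) as [->|Hc].
{ rewrite Cmod_0, Rmult_0_l. apply norm_ge_0. }
assert (H : norm x <= Cmod (/ c) * norm (scal c x)).
{ replace x with (scal (/ c)%C (scal c x)) at 1; [exact (norm_scal (/ c)%C (scal c x))|].
  rewrite scal_assoc.
  replace (mult (/ c)%C c) with (one : C_AbsRing); [apply scal_one|].
  symmetry. apply Cinv_l, Hc. }
rewrite Cmod_inv in H by exact Hc.
apply Cmod_gt_0 in Hc.
apply Rmult_le_compat_l with (r := Cmod c) in H; [|lra].
rewrite <- Rmult_assoc, Rinv_r, Rmult_1_l in H; lra.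
Qed.

Lemma op_norm_is_lub (A : X -> X) : is_linear A ->
  is_lub_Rbar (fun r => exists x : X, norm x <= 1 /\ r = norm (A x))
    (op_norm A).
Proof.
intros HA. unfold op_norm.
pose proof (Lub_Rbar_correct
  (fun r => exists x : X, norm x <= 1 /\ r = norm (A x))) as H.
destruct (Lub_Rbar _) as [l| |]; [exact H| |]; exfalso.
- destruct (linear_norm _ HA) as [M [HM HB]].
  apply (proj2 H M). intros r [x [Hx ->]].
  apply Rle_trans with (1 := HB x). simpl.
  pose proof (Rmult_le_compat_l M _ _ (Rlt_le _ _ HM) Hx). lra.
- apply (proj1 H (norm (A zero))). exists zero. split; [|reflexivity].
  rewrite norm_zero. lra.
Qed.

Lemma op_norm_ge_0 (A : X -> X) : is_linear A -> 0 <= op_norm A.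
Proof.
intros HA. apply Rle_trans with (norm (A zero)); [apply norm_ge_0|].
apply (proj1 (op_norm_is_lub A HA)). exists zero. split; [|reflexivity].
rewrite norm_zero. lra.
Qed.

Lemma op_norm_ub (A : X -> X) (x : X) : is_linear A ->
  norm (A x) <= op_norm A * norm x.
Proof.
intros HA. destruct (Req_dec (norm x) 0) as [H0|H0].
{ assert (x = zero) as -> by (apply norm_eq_zero, H0).
  rewrite (linear_zero _ HA), norm_zero. lra. }
assert (Hp : 0 < norm x) by (pose proof (norm_ge_0 x); lra).
assert (Hc : Cmod (RtoC (/ norm x)) = / norm x).
{ rewrite Cmod_R. apply Rabs_pos_eq, Rlt_le, Rinv_0_lt_compat, Hp. }
assert (H : norm (A (scal (RtoC (/ norm x)) x)) <= op_norm A).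
{ apply (proj1 (op_norm_is_lub A HA)). eexists. split; [|reflexivity].
  rewrite norm_scal_C, Hc, Rinv_l; lra. }
rewrite (linear_scal _ HA), norm_scal_C, Hc in H.
apply Rmult_le_compat_l with (r := norm x) in H; [|lra].
rewrite <- Rmult_assoc, Rinv_r, Rmult_1_l in H; lra.
Qed.

Lemma op_norm_le (A : X -> X) (M : R) : is_linear A -> 0 <= M ->
  (forall x : X, norm (A x) <= M * norm x) -> op_norm A <= M.
Proof.
intros HA HM H. apply (proj2 (op_norm_is_lub A HA) M).
intros r [x [Hx ->]]. simpl. apply Rle_trans with (1 := H x).
pose proof (Rmult_le_compat_l M _ _ HM Hx). lra.
Qed.

Lemma is_linear_op_pow (A : X -> X) (n : nat) :
  is_linear A -> is_linear (op_pow A n).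
Proof.
intros HA. induction n as [|n IH]; [apply is_linear_id|].
apply (is_linear_comp (op_pow A n) A IH HA).
Qed.

Lemma A11_abs_summable (w : A11) : ex_series (fun k => Cmod (w k)).
Proof.
apply (ex_series_le (V := R_CompleteNormedModule)) with (2 := coef_summable w).
intros k. change (norm (Cmod (w k))) with (Rabs (Cmod (w k))).
rewrite Rabs_pos_eq by apply Cmod_ge_0.
pose proof (Cmod_ge_0 (w k)). pose proof (pos_INR k).
rewrite plus_INR. simpl. nra.
Qed.

Lemma is_linear_sum_op (c : nat -> C) (S : X -> X) (n : nat) : is_linear S ->
  is_linear (fun x : X => sum_n (fun k => scal (c k) (op_pow S k x)) n).
Proof.
intros HS.
assert (H1 : forall k, is_linear (fun x : X => scal (c k) (op_pow S k x))).
{ intros k. apply (is_linear_comp (op_pow S k) (fun x => scal (c k) x)).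
  - apply is_linear_op_pow, HS.
  - exact (@is_linear_scal_r C_AbsRing X (c k) Cmult_comm). }
induction n as [|n IH].
- apply is_linear_ext with (2 := H1 0%nat). intros x. now rewrite sum_O.
- apply is_linear_ext with (l1 := fun x : X =>
    (fun p : X * X => plus (fst p) (snd p))
      ((fun x => (sum_n (fun k => scal (c k) (op_pow S k x)) n,
                  scal (c (Datatypes.S n)) (op_pow S (Datatypes.S n) x))) x)).
  { intros x. now rewrite sum_Sn. }
  apply (is_linear_comp (fun x : X =>
    (sum_n (fun k => scal (c k) (op_pow S k x)) n,
     scal (c (Datatypes.S n)) (op_pow S (Datatypes.S n) x)))
    (fun p : X * X => plus (fst p) (snd p))).
  + split.
    * intros x y. rewrite (linear_plus _ IH), (linear_plus _ (H1 _)).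
      reflexivity.
    * intros a x. rewrite (linear_scal _ IH), (linear_scal _ (H1 _)).
      reflexivity.
    * destruct (linear_norm _ IH) as [M1 [HM1 B1]].
      destruct (linear_norm _ (H1 (Datatypes.S n))) as [M2 [HM2 B2]].
      exists (sqrt 2 * (M1 + M2)). pose proof Rlt_sqrt2_0. split; [nra|].
      intros x. eapply Rle_trans; [apply norm_prod|]. simpl.
      rewrite Rmult_assoc. apply Rmult_le_compat_l; [lra|].
      pose proof (norm_ge_0 x).
      apply Rmax_lub;
        [eapply Rle_trans; [apply B1|]|eapply Rle_trans; [apply B2|]]; nra.
  + apply is_linear_plus.
Qed.

Lemma is_linear_minus_op (A B : X -> X) : is_linear A -> is_linear B ->
  is_linear (fun x : X => minus (A x) (B x)).
Proof.
intros HA HB. split.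
- intros x y. rewrite (linear_plus _ HA), (linear_plus _ HB).
  exact (minus_plus_plus _ _ _ _).
- intros a x. rewrite (linear_scal _ HA), (linear_scal _ HB).
  symmetry. exact (scal_minus_distr_l _ _ _).
- destruct (linear_norm _ HA) as [M1 [HM1 B1]].
  destruct (linear_norm _ HB) as [M2 [HM2 B2]].
  exists (M1 + M2). split; [lra|]. intros x. unfold minus.
  eapply Rle_trans; [apply norm_triangle|]. rewrite norm_opp.
  rewrite Rmult_plus_distr_r. apply Rplus_le_compat; auto.
Qed.

Lemma norm_minus_plus_r (a b c : X) :
  norm (minus a (plus b c)) <= norm (minus a b) + norm c.
Proof.
replace (minus a (plus b c)) with (plus (minus a b) (opp c))
  by (symmetry; exact (minus_plus_r a b c)).
rewrite <- (norm_opp c). apply norm_triangle.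
Qed.

Lemma norm_le_minus (a b : X) : norm b <= norm a + norm (minus a b).
Proof.
rewrite <- (minus_minus_cancel a b) at 1. rewrite <- (norm_opp (minus a b)).
apply norm_triangle.
Qed.

Lemma is_lim_seq_norm_minus (a l : X) (u : nat -> X) :
  filterlim u eventually (locally l) ->
  is_lim_seq (fun m => norm (minus a (u m))) (norm (minus a l)).
Proof.
intros Hu.
apply (filterlim_comp _ _ _ (fun m => minus a (u m)) (fun z : X => norm z) _
  (locally (minus a l))); [|apply filterlim_norm].
apply (filterlim_comp_2 (fun _ => a) (fun m => opp (u m)) plus
  (G := locally a) (H := locally (opp l))).
- apply filterlim_const.
- apply (filterlim_comp _ _ _ u opp _ (locally l)); [exact Hu|].
  exact (filterlim_opp l).
- exact (filterlim_plus a (opp l)).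
Qed.

End Facts.

Section Existence.
Context {X : CompleteNormedModule C_AbsRing}.

Lemma op_series_ex (w : A11) (S : X -> X) :
  is_linear S -> power_bounded S -> exists W : X -> X, is_op_series w S W.
Proof.
intros HS [M HM].
assert (HM0 : 0 <= M).
{ apply Rle_trans with (2 := HM 0%nat). apply op_norm_ge_0, is_linear_id. }
assert (Hterm : forall x k,
  norm (scal (w k) (op_pow S k x)) <= Cmod (w k) * (M * norm x)).
{ intros x k. rewrite norm_scal_C.
  apply Rmult_le_compat_l; [apply Cmod_ge_0|].
  eapply Rle_trans; [apply op_norm_ub, is_linear_op_pow, HS|].
  apply Rmult_le_compat_r; [apply norm_ge_0|apply HM]. }
assert (Hex : forall x, ex_series (fun k => scal (w k) (op_pow S k x))).
{ intros x. apply ex_series_le with (1 := Hterm x).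
  apply (ex_series_scal_r (M * norm x)), A11_abs_summable. }
pose (W := fun x : X =>
  iota (is_series (fun k => scal (w k) (op_pow S k x)))).
assert (HW : forall x, is_series (fun k => scal (w k) (op_pow S k x)) (W x)).
{ intros x. destruct (Hex x) as [l Hl].
  replace (W x) with l; [exact Hl|]. symmetry.
  exact (iota_filterlim_locally _ l Hl). }
assert (Huniq : forall (a : nat -> X) l l',
  is_series a l -> is_series a l' -> l = l').
{ intros a l l' H H'.
  exact (filterlim_locally_unique _ l l' H H'). }
(* tail of the sum of the [Cmod (w k)] *)
pose (r := fun n => Series (fun k => Cmod (w k)) - sum_n (fun k => Cmod (w k)) n).
assert (Hr : is_lim_seq r 0).
{ replace (Finite 0) with (Finite (Series (fun k => Cmod (w k))
    - Series (fun k => Cmod (w k)))) by (apply f_equal; ring).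
  apply is_lim_seq_minus'; [apply is_lim_seq_const|].
  exact (Series_correct _ (A11_abs_summable w)). }
assert (Hr0 : forall n, 0 <= r n).
{ intros n. unfold r.
  cut (sum_n (fun k => Cmod (w k)) n <= Series (fun k => Cmod (w k))); [lra|].
  apply (is_lim_seq_incr_compare (sum_n (fun k => Cmod (w k)))).
  - exact (Series_correct _ (A11_abs_summable w)).
  - intros m. rewrite sum_Sn. change plus with Rplus.
    pose proof (Cmod_ge_0 (w (Datatypes.S m))). lra. }
assert (Hrem : forall n x,
  norm (minus (sum_n (fun k => scal (w k) (op_pow S k x)) n) (W x))
    <= r n * M * norm x).
{ intros n x.
  assert (Hle : forall m, (n <= m)%nat ->
    norm (minus (sum_n (fun k => scal (w k) (op_pow S k x)) n)
                (sum_n (fun k => scal (w k) (op_pow S k x)) m))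
      <= (sum_n (fun k => Cmod (w k)) m - sum_n (fun k => Cmod (w k)) n)
         * (M * norm x)).
  { intros m Hm. induction Hm as [|m Hm IH].
    - rewrite Rminus_diag, Rmult_0_l. right.
      rewrite minus_eq_zero. exact norm_zero.
    - rewrite !sum_Sn. change (@plus R_AbelianMonoid) with Rplus.
      eapply Rle_trans; [apply norm_minus_plus_r|].
      eapply Rle_trans; [apply Rplus_le_compat; [exact IH|apply Hterm]|].
      right. ring. }
  assert (Hlim : is_lim_seq (fun m =>
    norm (minus (sum_n (fun k => scal (w k) (op_pow S k x)) n)
                (sum_n (fun k => scal (w k) (op_pow S k x)) m)))
    (norm (minus (sum_n (fun k => scal (w k) (op_pow S k x)) n) (W x)))).
  { exact (is_lim_seq_norm_minus _ _ _ (HW x)). }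
  assert (Hlim2 : is_lim_seq (fun m =>
    (sum_n (fun k => Cmod (w k)) m - sum_n (fun k => Cmod (w k)) n)
      * (M * norm x)) (r n * (M * norm x))).
  { apply is_lim_seq_mult'; [|apply is_lim_seq_const].
    apply is_lim_seq_minus'; [|apply is_lim_seq_const].
    exact (Series_correct _ (A11_abs_summable w)). }
  rewrite Rmult_assoc.
  apply (is_lim_seq_le_loc _ _ (Finite _) (Finite _)) with (2 := Hlim) (3 := Hlim2).
  exists n. exact Hle. }
assert (HWlin : is_linear W).
{ split.
  - intros x y. apply (Huniq _ _ _ (HW (plus x y))).
    apply is_series_ext with (fun k =>
      plus (scal (w k) (op_pow S k x)) (scal (w k) (op_pow S k y))).
    + intros k. rewrite (linear_plus _ (is_linear_op_pow S k HS)).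
      symmetry. exact (scal_distr_l (w k) (op_pow S k x) (op_pow S k y)).
    + exact (is_series_plus _ _ _ _ (HW x) (HW y)).
  - intros a x. apply (Huniq _ _ _ (HW (scal a x))).
    apply is_series_ext with (fun k => scal a (scal (w k) (op_pow S k x))).
    + intros k. rewrite (linear_scal _ (is_linear_op_pow S k HS)).
      transitivity (scal (Cmult a (w k)) (op_pow S k x)).
      * exact (scal_assoc a (w k) (op_pow S k x)).
      * rewrite Cmult_comm. symmetry.
        exact (scal_assoc (w k) a (op_pow S k x)).
    + exact (is_series_scal a _ _ (HW x)).
  - destruct (linear_norm _ (is_linear_sum_op w S 0 HS)) as [M1 [HM1 B1]].
    exists (M1 + r 0%nat * M). split; [pose proof (Hr0 0%nat); nra|].
    intros x.
    set (s := sum_n (fun k => scal (w k) (op_pow S k x)) 0).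
    rewrite Rmult_plus_distr_r.
    eapply Rle_trans; [apply (norm_le_minus s)|].
    apply Rplus_le_compat; [apply B1|apply Hrem]. }
exists W. split; [exact HWlin|].
assert (Hd : forall n, is_linear (fun x : X =>
  minus (sum_n (fun k => scal (w k) (op_pow S k x)) n) (W x))).
{ intros n. apply is_linear_minus_op; [apply is_linear_sum_op, HS|exact HWlin]. }
apply is_lim_seq_le_le with (u := fun _ => 0) (w := fun n => r n * M).
- intros n. split; [apply op_norm_ge_0, Hd|].
  apply op_norm_le; [apply Hd|pose proof (Hr0 n); nra|apply Hrem].
- apply is_lim_seq_const.
- replace (Finite 0) with (Finite (0 * M)) by (apply f_equal; ring).
  apply is_lim_seq_mult'; [exact Hr|apply is_lim_seq_const].
Qed.

Lemma A11_op_correct (w : A11) (S : X -> X) :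
  is_linear S -> power_bounded S -> is_op_series w S (A11_op w S).
Proof.
intros HS HP. unfold A11_op. apply epsilon_spec, op_series_ex; assumption.
Qed.

End Existence.

(* Main.v *)
Require Import Defs.
From Stdlib Require Import Reals Lra Lia ZArith List FinFun Classical ClassicalEpsilon.
From Coquelicot Require Import Coquelicot.
Open Scope R_scope.

(** The spectral mapping theorem is made quantitative. For [mu] on the unit
    circle and [n >= 1], the operator [w(mu ^ n) - w(T ^ n)] is a multiple of
    [mu - T] ([calculus_factor]): termwise this is the factorization of
    [mu ^ (n k) - T ^ (n k)], and the cofactor has norm at most [C n] because
    [T] is power bounded and [sum_k (k + 1) |w k|] is finite. If
    [|w(mu ^ n)| >= q + d] then, since [|w(T ^ n)| <= q], that multiple is
    invertible with inverse of norm at most [1 / d], hence so is [mu - T], and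
    [|(mu - T)^-1| <= C n / d] ([resolvent_on_circle]). Everything then depends
    on how soon an orbit [mu, mu ^ 2, ...] visits the set where [|w| > q].

    The answer is elementary ([E_set_escape]): for a fixed [d > 0] and each [mu]
    outside [E] there is such an [n] with [n <= C], or with [n <= C / |mu - u|]
    for some [u] in [E]. By Dirichlet's approximation theorem [mu] is close to
    a root of unity [u] of bounded order [k], and unless [mu = u] the powers of
    [mu ^ k] go around the circle in short steps, in about [1 / |mu - u|] powers
    of [mu] ([circle_dirichlet]); on the way they pass near a point where
    [|w| > q]. So the elements of [E] are among these finitely many roots of
    unity. If [u] is not in [E], some power of [u] already violates the bound
    that defines [E], and so does the same power of a nearby [mu].

    Together these give [|(mu - T)^-1| <= K / dist(mu, E)] on the circle
    ([resolvent_circle_bound]), hence the inclusion of the peripheral spectrum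
    in [E]. When [E] is empty the bound is uniform, and perturbing the resolvent
    gives a spectral radius below [1]. Otherwise [1 = u ^ m] for [u] in [E] of
    order [m], so [1] is in [E] with [u]. Power boundedness and the resolvent
    identity extend the bound to the exterior of the disc ([ritt_from_circle]),
    which is the Ritt condition on [E].

    For [T ^ N], the partial fractions of [1 / (mu - t ^ N)] write its resolvent
    as an average of the resolvents of [T] at the [N]-th roots [nu] of [mu]
    ([resolvent_op_pow]). Since [u ^ N = 1] for [u] in [E], each [nu] satisfies
    [|mu - 1| <= N |nu - u|], so the bound for [T] near [E] becomes one for
    [T ^ N] near [1]. *)

(** * Diophantine approximation on the circle *)

(** The point [e ^ (i t)] of the unit circle. *)
Definition cis (t : R) : C := (cos t, sin t).

Lemma cis_0 : cis 0 = 1%C.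
Proof. unfold cis. now rewrite cos_0, sin_0. Qed.

Lemma cis_plus (a b : R) : cis (a + b) = (cis a * cis b)%C.
Proof.
unfold cis, Cmult. simpl. rewrite cos_plus, sin_plus. f_equal. ring.
Qed.

Lemma cis_pow (t : R) (n : nat) : (cis t ^ n)%C = cis (INR n * t).
Proof.
induction n as [|n IH].
- simpl INR. now rewrite Rmult_0_l, cis_0.
- rewrite Cpow_S, IH, <- cis_plus, S_INR. f_equal. ring.
Qed.

Lemma Cmod_cis_minus (a b : R) : Cmod (cis a - cis b)%C <= Rabs (a - b).
Proof.
unfold Cmod, cis. simpl. rewrite <- (sqrt_Rsqr_abs (a - b)).
apply sqrt_le_1_alt.
assert (H : forall t, 0 <= t -> 1 - cos t <= t * t / 2).
{ intros t Ht.
  replace (cos t) with (1 - 2 * sin (t / 2) * sin (t / 2)).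
  2:{ rewrite <- cos_2a_sin. f_equal. field. }
  assert (Hs : Rabs (sin (t / 2)) <= t / 2).
  { destruct (Req_dec t 0) as [->|Ht0].
    - rewrite Rdiv_0_l, sin_0, Rabs_R0. lra.
    - apply Rabs_le. split.
      + destruct (Rle_dec (t / 2) PI) as [Hp|Hp].
        * pose proof (sin_ge_0 (t / 2)). lra.
        * pose proof (SIN_bound (t / 2)). pose proof PI_RGT_0.
          pose proof PI2_1. lra.
      + apply Rlt_le, sin_lt_x. lra. }
  pose proof (Rsqr_le_abs_1 (sin (t / 2)) (t / 2)) as H2.
  rewrite (Rabs_pos_eq (t / 2)) in H2 by lra.
  specialize (H2 Hs). unfold Rsqr in H2. lra. }
assert (H' : 1 - cos (a - b) <= (a - b) * (a - b) / 2).
{ destruct (Rle_dec 0 (a - b)) as [Hp|Hp]; [apply H, Hp|].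
  rewrite <- cos_neg. replace ((a - b) * (a - b)) with (- (a - b) * - (a - b)) by ring.
  apply H. lra. }
rewrite cos_minus in H'. unfold Rsqr.
pose proof (sin2_cos2 a) as Ha. pose proof (sin2_cos2 b) as Hb.
unfold Rsqr in Ha, Hb. nra.
Qed.

Lemma unit_circle_angle (z : C) : unit_circle z ->
  exists t, z = cis t /\ - PI <= t <= PI.
Proof.
intros Hz. destruct z as [x y].
assert (H : x * x + y * y = 1).
{ unfold unit_circle, Cmod in Hz. simpl in Hz.
  apply (f_equal Rsqr) in Hz. rewrite Rsqr_sqrt in Hz by nra.
  unfold Rsqr in Hz. lra. }
assert (Hx : -1 <= x <= 1) by nra.
assert (Hy : sqrt (1 - x²) = Rabs y).
{ rewrite <- sqrt_Rsqr_abs. f_equal. unfold Rsqr. lra. }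
pose proof (acos_bound x) as Ha.
destruct (Rle_dec 0 y) as [Hy0|Hy0].
- exists (acos x). split; [|lra].
  unfold cis. rewrite cos_acos, sin_acos, Hy, Rabs_pos_eq; auto.
- exists (- acos x). split; [|lra].
  unfold cis. rewrite cos_neg, sin_neg, cos_acos, sin_acos, Hy, Rabs_left by lra.
  f_equal. ring.
Qed.

Lemma cis_period_Z (k : Z) : cis (2 * PI * IZR k) = 1%C.
Proof.
assert (Hn : forall n : nat, cis (2 * PI * INR n) = 1%C).
{ intros n. rewrite Rmult_comm, <- cis_pow.
  replace (cis (2 * PI)) with (RtoC 1); [apply Cpow_1_l|].
  unfold cis. now rewrite cos_2PI, sin_2PI. }
destruct (Z_lt_le_dec k 0) as [Hk|Hk].
- transitivity (cis (2 * PI * IZR k) * cis (2 * PI * INR (Z.to_nat (- k))))%C.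
  + rewrite Hn. ring.
  + rewrite <- cis_plus, INR_IZR_INZ, Z2Nat.id, opp_IZR, <- cis_0 by lia.
    f_equal. ring.
- rewrite <- (Z2Nat.id k Hk), <- INR_IZR_INZ. apply Hn.
Qed.

(** The two ranges of angles let a walk on the circle reach a point going
    in either direction. *)
Lemma unit_circle_signed_angle (z : C) (s : R) :
  unit_circle z -> s = 1 \/ s = -1 ->
  exists t, z = cis t /\ 0 <= s * t <= 2 * PI.
Proof.
intros Hz Hs. destruct (unit_circle_angle z Hz) as [t [-> Ht]].
destruct (Rle_dec 0 (s * t)) as [H|H].
- exists t. split; [reflexivity|]. destruct Hs; subst; nra.
- exists (t + 2 * PI * s). split.
  + rewrite cis_plus.
    replace s with (IZR (if Req_dec_T s 1 then 1 else -1)).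
    * rewrite cis_period_Z. ring.
    * destruct (Req_dec_T s 1) as [->|]; [reflexivity|].
      destruct Hs as [| ->]; [easy|reflexivity].
  + destruct Hs; subst; nra.
Qed.

(** Dirichlet's theorem: two of the fractional parts of [0 * x], ..., [M * x]
    fall in the same of [M] boxes. *)
Lemma dirichlet_approximation (x : R) (M : nat) : (1 <= M)%nat ->
  exists (k : nat) (p : Z), (1 <= k <= M)%nat /\
    Rabs (INR k * x - IZR p) <= / INR M.
Proof.
intros HM.
assert (HM0 : 0 < INR M) by (apply lt_0_INR; lia).
pose (fl := fun r => (up r - 1)%Z).
assert (Hfl : forall r, IZR (fl r) <= r < IZR (fl r) + 1).
{ intros r. unfold fl. rewrite minus_IZR. pose proof (archimed r). lra. }
pose (frac := fun i : nat => INR i * x - IZR (fl (INR i * x))).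
assert (Hfrac : forall i, 0 <= frac i < 1).
{ intros i. unfold frac. pose proof (Hfl (INR i * x)). lra. }
pose (box := fun i => Z.to_nat (fl (INR M * frac i))).
assert (Hbox0 : forall i, (0 <= fl (INR M * frac i)%R < Z.of_nat M)%Z).
{ intros i. pose proof (Hfl (INR M * frac i)) as H1. pose proof (Hfrac i) as H2.
  split.
  - apply Z.lt_succ_r, lt_IZR. unfold Z.succ. rewrite plus_IZR. nra.
  - apply lt_IZR. rewrite <- INR_IZR_INZ. nra. }
assert (Hcol : exists i j, (i < j <= M)%nat /\ box i = box j).
{ apply NNPP. intros Hno.
  assert (Hnd : NoDup (map box (seq 0 (S M)))).
  { apply Injective_map_NoDup_in; [|apply seq_NoDup].
    intros i j Hi Hj Hij. apply in_seq in Hi, Hj.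
    destruct (Nat.lt_trichotomy i j) as [H|[H|H]]; [|exact H|];
      exfalso; apply Hno; [exists i, j|exists j, i]; (split; [lia|auto]). }
  apply NoDup_incl_length with (l' := seq 0 M) in Hnd.
  - rewrite length_map, !length_seq in Hnd. lia.
  - intros b Hb. apply in_map_iff in Hb. destruct Hb as [i [<- _]].
    apply in_seq. unfold box. pose proof (Hbox0 i). lia. }
destruct Hcol as [i [j [Hij Hb]]].
exists (j - i)%nat, (fl (INR j * x)%R - fl (INR i * x)%R)%Z. split; [lia|].
rewrite minus_INR, minus_IZR by lia.
replace ((INR j - INR i) * x - (IZR (fl (INR j * x)) - IZR (fl (INR i * x))))
  with (frac j - frac i) by (unfold frac; ring).
unfold box in Hb. apply Z2Nat.inj in Hb; try apply Hbox0.
pose proof (Hfl (INR M * frac i)) as Hi. pose proof (Hfl (INR M * frac j)) as Hj.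
rewrite Hb in Hi.
assert (HI : INR M * / INR M = 1) by (apply Rinv_r; lra).
apply Rabs_le. split; apply Rmult_le_reg_l with (INR M); nra.
Qed.

(** Small steps of an arithmetic progression of angles come close to every
    point in at most one turn and one step: [9] bounds [2 pi + 1]. *)
Lemma cis_walk (b : R) (z : C) : b <> 0 -> Rabs b <= 1 -> unit_circle z ->
  exists j : nat, (1 <= j)%nat /\ Cmod (cis (INR j * b) - z)%C <= Rabs b /\
    INR j * Rabs b <= 9.
Proof.
intros Hb Hb1 Hz.
assert (Hs : exists s, (s = 1 \/ s = -1) /\ Rabs b = s * b).
{ destruct (Rle_dec 0 b).
  - exists 1. split; [auto|]. rewrite Rabs_pos_eq; lra.
  - exists (-1). split; [auto|]. rewrite Rabs_left; lra. }
destruct Hs as [s [Hs Hsb]].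
assert (Hb0 : 0 < Rabs b) by now apply Rabs_pos_lt.
destruct (unit_circle_signed_angle z s Hz Hs) as [t [-> Ht]].
destruct (archimed (s * t / Rabs b)) as [Hu1 Hu2].
assert (Hq : 0 <= s * t / Rabs b).
{ apply Rmult_le_pos; [lra|]. apply Rlt_le, Rinv_0_lt_compat, Hb0. }
set (u := up (s * t / Rabs b)) in *.
assert (Hu0 : (0 < u)%Z) by (apply lt_IZR; lra).
assert (Hst : s * t = s * t / Rabs b * Rabs b) by (field; lra).
exists (Z.to_nat u). split; [lia|].
rewrite INR_IZR_INZ, Z2Nat.id by lia. split.
- eapply Rle_trans; [apply Cmod_cis_minus|].
  assert (Hd : 0 <= s * (IZR u * b - t) <= Rabs b).
  { replace (s * (IZR u * b - t)) with (IZR u * (s * b) - s * t) by ring.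
    rewrite <- Hsb. nra. }
  destruct Hs; subst s; unfold Rabs at 1; destruct (Rcase_abs _); lra.
- pose proof PI_4. nra.
Qed.

(** Writing [mu = e ^ (i t)], Dirichlet's theorem provides a root of unity
    [u] of bounded order [k] such that [mu ^ k] is close to [1]. Unless
    [mu = u], the powers of [mu ^ k] then walk around the circle by short
    steps. Their length is [k] times the angle between [mu] and [u], so about
    [1 / |mu - u|] powers of [mu] make a full turn. *)
Lemma circle_dirichlet (eta : R) : 0 < eta ->
  exists L : list C, (forall u, In u L -> root_of_unity u) /\
  forall mu, unit_circle mu -> exists u, In u L /\
    (mu = u \/ forall z, unit_circle z -> exists n : nat, (1 <= n)%nat /\
      Cmod (mu ^ n - z)%C <= eta /\ INR n * Cmod (mu - u)%C <= 9).
Proof.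
intros Heta.
pose proof PI_RGT_0 as Hpi.
assert (HM : exists M : nat, (1 <= M)%nat /\ 2 * PI / INR M <= Rmin eta 1).
{ assert (Hm : 0 < Rmin eta 1) by (apply Rmin_pos; lra).
  destruct (INR_unbounded (2 * PI / Rmin eta 1)) as [M HM].
  assert (H0 : 0 < 2 * PI / Rmin eta 1) by (apply Rdiv_lt_0_compat; lra).
  exists M. split.
  - assert (0 < M)%nat by (apply INR_lt; simpl; lra). lia.
  - apply Rle_div_l; [lra|]. apply Rgt_lt, Rlt_div_l in HM; [nra|exact Hm]. }
destruct HM as [M [HM1 HM]].
assert (HM0 : 1 <= INR M) by (apply (le_INR 1), HM1).
(* The numerators [p] of the angles [2 pi p / k] range over
   [-(M + 1) .. M + 1]; they are shifted to natural numbers. *)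
exists (map (fun kp => cis (2 * PI * (IZR (Z.of_nat (snd kp) - Z.of_nat (S M))
                                        / INR (fst kp))))
         (list_prod (seq 1 M) (seq 0 (2 * M + 3)))).
split.
- intros u Hu. apply in_map_iff in Hu. destruct Hu as [[k p] [<- Hkp]].
  apply in_prod_iff in Hkp. destruct Hkp as [Hk _]. apply in_seq in Hk.
  exists k. split; [lia|]. rewrite cis_pow. simpl fst. simpl snd.
  replace (INR k * _) with (2 * PI * IZR (Z.of_nat p - Z.of_nat (S M))).
  + apply cis_period_Z.
  + field. apply not_0_INR. lia.
- intros mu Hmu. destruct (unit_circle_angle mu Hmu) as [t [-> Ht]].
  destruct (dirichlet_approximation (t / (2 * PI)) M HM1) as [k [p [Hk Hp]]].
  assert (Hk0 : 1 <= INR k) by (apply (le_INR 1); lia).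
  assert (HkM : INR k <= INR M) by (apply le_INR; lia).
  assert (Hpb : (- Z.of_nat (S M) <= p <= Z.of_nat (S M))%Z).
  { assert (HI : / INR M <= 1) by (rewrite <- Rinv_1; apply Rinv_le_contravar; lra).
    assert (Hx : -1 <= t / (2 * PI) <= 1).
    { split; [apply Rle_div_r|apply Rle_div_l]; lra. }
    pose proof (proj1 (Rabs_le_between _ _) Hp) as Hp'.
    rewrite Nat2Z.inj_succ. unfold Z.succ.
    split; apply le_IZR; rewrite ?opp_IZR, plus_IZR, <- INR_IZR_INZ; nra. }
  exists (cis (2 * PI * (IZR p / INR k))). split.
  { apply in_map_iff. exists (k, Z.to_nat (p + Z.of_nat (S M))). simpl fst. simpl snd.
    split; [do 4 f_equal; lia|].
    apply in_prod_iff. rewrite !in_seq. lia. }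
  set (a := t - 2 * PI * (IZR p / INR k)).
  assert (Ha : INR k * a = 2 * PI * (INR k * (t / (2 * PI)) - IZR p)).
  { unfold a. field. lra. }
  destruct (Req_dec a 0) as [Ha0|Ha0].
  { left. f_equal. unfold a in Ha0. lra. }
  right. intros z Hz.
  assert (Hka : Rabs (INR k * a) <= Rmin eta 1).
  { rewrite Ha, Rabs_mult, Rabs_pos_eq by lra.
    eapply Rle_trans; [|exact HM]. apply Rmult_le_compat_l; [lra|exact Hp]. }
  pose proof (Rmin_l eta 1). pose proof (Rmin_r eta 1).
  destruct (cis_walk (INR k * a) z) as [j [Hj [Hjz Hjn]]]; [nra|lra|exact Hz|].
  exists (k * j)%nat. split; [nia|]. rewrite mult_INR. split.
  + replace (cis t ^ (k * j))%C with (cis (INR j * (INR k * a))); [lra|].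
    rewrite cis_pow, mult_INR.
    (* The angles [j k t] and [j k a] differ by [2 pi j p], since [u ^ k = 1]. *)
    transitivity (cis (INR j * (INR k * a) + 2 * PI * IZR (Z.of_nat j * p))).
    * rewrite cis_plus, cis_period_Z. ring.
    * f_equal. rewrite mult_IZR, <- INR_IZR_INZ. unfold a. field. lra.
  + rewrite Rabs_mult, (Rabs_pos_eq (INR k)) in Hjn by lra.
    eapply Rle_trans; [|exact Hjn].
    replace (INR k * INR j * Cmod (cis t - cis (2 * PI * (IZR p / INR k))))
      with (INR j * (INR k * Cmod (cis t - cis (2 * PI * (IZR p / INR k))))) by ring.
    apply Rmult_le_compat_l; [apply pos_INR|].
    apply Rmult_le_compat_l; [lra|]. apply Cmod_cis_minus.
Qed.

(** * Functions of the algebra on the circle *)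

Lemma norm_is_series_le {V : NormedModule C_AbsRing} (a : nat -> V) (l : V)
    (b : nat -> R) (s : R) :
  is_series a l -> is_series b s -> (forall k, norm (a k) <= b k) -> norm l <= s.
Proof.
intros Ha Hb Hab.
apply (is_lim_seq_le (fun n => norm (sum_n a n)) (sum_n b) (norm l) s).
- intros n. eapply Rle_trans; [apply norm_sum_n_m|].
  apply sum_n_m_le, Hab.
- apply (filterlim_comp _ _ _ (sum_n a) norm _ (locally l)); [exact Ha|].
  apply filterlim_norm.
- exact Hb.
Qed.

Definition A11_norm (w : A11) : R := Series (fun k => INR (k + 1) * Cmod (w k)).

Lemma is_series_A11_norm (w : A11) :
  is_series (fun k => INR (k + 1) * Cmod (w k)) (A11_norm w).
Proof. apply Series_correct, coef_summable. Qed.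

Lemma A11_norm_ge_0 (w : A11) : 0 <= A11_norm w.
Proof.
apply Rle_trans with (norm (zero : C_NormedModule)); [apply norm_ge_0|].
apply norm_is_series_le with (fun _ => zero) (fun k => INR (k + 1) * Cmod (w k)).
- apply (filterlim_ext (fun _ => zero)); [|apply filterlim_const].
  intros n. symmetry. apply sum_n_m_const_zero.
- apply is_series_A11_norm.
- intros k. rewrite norm_zero.
  apply Rmult_le_pos; [apply pos_INR|apply Cmod_ge_0].
Qed.

Lemma is_series_A11_eval (w : A11) (z : C) : unit_circle z ->
  is_series (V := C_NormedModule) (fun k => w k * z ^ k)%C (A11_eval w z).
Proof.
intros Hz.
assert (H : ex_series (V := C_CompleteNormedModule) (fun k => w k * z ^ k)%C).
{ apply ex_series_le with (2 := A11_abs_summable w).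
  intros k. change norm with Cmod.
  rewrite Cmod_mult, Cmod_pow, Hz, pow1. lra. }
destruct H as [l Hl].
replace (A11_eval w z) with l; [exact Hl|]. symmetry.
exact (iota_filterlim_locally _ l Hl).
Qed.

Lemma unit_circle_pow (z : C) (n : nat) : unit_circle z -> unit_circle (z ^ n)%C.
Proof. unfold unit_circle. intros H. now rewrite Cmod_pow, H, pow1. Qed.

Lemma Cmod_pow_minus_le (a b : C) (n : nat) : unit_circle a -> unit_circle b ->
  Cmod (a ^ n - b ^ n)%C <= INR n * Cmod (a - b)%C.
Proof.
intros Ha Hb. induction n as [|n IH].
- simpl Cpow. replace (1 - 1)%C with (RtoC 0) by ring. rewrite Cmod_0. simpl. lra.
- rewrite !Cpow_S, S_INR.
  replace (a * a ^ n - b * b ^ n)%C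
    with (a * (a ^ n - b ^ n) + (a - b) * b ^ n)%C by ring.
  eapply Rle_trans; [apply Cmod_triangle|].
  rewrite !Cmod_mult, Cmod_pow, Ha, Hb, pow1. lra.
Qed.

Lemma A11_eval_lipschitz (w : A11) (a b : C) : unit_circle a -> unit_circle b ->
  Cmod (A11_eval w a - A11_eval w b)%C <= A11_norm w * Cmod (a - b)%C.
Proof.
intros Ha Hb.
apply (norm_is_series_le (V := C_NormedModule)
  (fun k => w k * a ^ k - w k * b ^ k)%C _
  (fun k => INR (k + 1) * Cmod (w k) * Cmod (a - b)%C)).
- exact (is_series_minus _ _ _ _ (is_series_A11_eval w a Ha)
    (is_series_A11_eval w b Hb)).
- apply (is_series_scal_r (Cmod (a - b)%C)), is_series_A11_norm.
- intros k. change norm with Cmod.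
  replace (w k * a ^ k - w k * b ^ k)%C with (w k * (a ^ k - b ^ k))%C by ring.
  rewrite Cmod_mult, plus_INR. simpl INR.
  pose proof (Cmod_pow_minus_le a b k Ha Hb). pose proof (Cmod_ge_0 (w k)).
  pose proof (Cmod_ge_0 (a - b)%C). nra.
Qed.

Lemma Cmod_ge_minus (a b : C) : Cmod a - Cmod (b - a)%C <= Cmod b.
Proof.
rewrite <- (Cmod_opp (b - a)%C).
pose proof (Cmod_triangle b (- (b - a))%C) as H.
replace (b + - (b - a))%C with a in H by ring. lra.
Qed.

Lemma A11_eval_near (w : A11) (a b : C) (r d : R) :
  unit_circle a -> unit_circle b -> r + d <= Cmod (A11_eval w a) ->
  A11_norm w * Cmod (b - a)%C <= d -> r <= Cmod (A11_eval w b).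
Proof.
intros Ha Hb Hr Hd.
pose proof (A11_eval_lipschitz w b a Hb Ha).
pose proof (Cmod_ge_minus (A11_eval w a) (A11_eval w b)). lra.
Qed.

Lemma A11_norm_attained (w : A11) (q : R) : 0 <= q -> q < A11_norm_infty w ->
  exists z, unit_circle z /\ q < Cmod (A11_eval w z).
Proof.
intros Hq0 Hq. unfold A11_norm_infty in Hq.
pose proof (Lub_Rbar_correct (fun r =>
  exists z : C, unit_circle z /\ r = Cmod (A11_eval w z))) as H.
destruct (Lub_Rbar _) as [l| |]; simpl in Hq; try lra.
apply NNPP. intros Hno. apply (Rlt_not_le _ _ Hq), (proj2 H q).
intros r [z [Hz ->]]. simpl. apply Rnot_lt_le. intros Hr. apply Hno. eauto.
Qed.

(** Each [u] outside [E] has an exponent that violates the bound [q]. Finitely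
    many points admit a common bound for the exponents and a common excess,
    which is why approximation by a finite list of roots of unity suffices. *)
Lemma E_set_compl_uniform (w : A11) (q : R) (L : list C) :
  exists (C0 d : R), 0 < d /\ 0 <= C0 /\
    forall u, In u L -> unit_circle u -> ~ E_set w q u ->
    exists n : nat, (1 <= n)%nat /\ INR n <= C0 /\
      q + d <= Cmod (A11_eval w (u ^ n)%C).
Proof.
induction L as [|v L [C0 [d [Hd [HC0 IH]]]]].
- exists 0, 1. split; [lra|]. split; [lra|]. intros u [].
- destruct (classic (exists n, (1 <= n)%nat /\ q < Cmod (A11_eval w (v ^ n)%C)))
    as [[n [Hn Hv]]|Hv].
  + exists (Rmax C0 (INR n)), (Rmin d (Cmod (A11_eval w (v ^ n)%C) - q)).
    pose proof (Rmax_l C0 (INR n)). pose proof (Rmax_r C0 (INR n)).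
    split; [apply Rmin_pos; lra|]. split; [lra|].
    intros u [->|Hu] Hu1 HuE.
    * exists n. pose proof (Rmin_r d (Cmod (A11_eval w (u ^ n)%C) - q)).
      repeat split; auto. lra.
    * destruct (IH u Hu Hu1 HuE) as [m [Hm1 [Hm2 Hm3]]]. exists m.
      pose proof (Rmin_l d (Cmod (A11_eval w (v ^ n)%C) - q)).
      repeat split; auto; lra.
  + exists C0, d. split; [exact Hd|]. split; [exact HC0|].
    intros u [->|Hu] Hu1 HuE; [|now apply IH].
    exfalso. apply HuE. split; [exact Hu1|]. intros n Hn.
    apply Rnot_lt_le. intros Hlt. apply Hv. eauto.
Qed.

Lemma root_of_unity_unit_circle (z : C) : root_of_unity z -> unit_circle z.
Proof.
intros [m [Hm Hz]]. apply (f_equal Cmod) in Hz.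
rewrite Cmod_pow, Cmod_1 in Hz.
destruct (pow_R1 _ _ Hz) as [H|H]; [|lia].
now rewrite Rabs_pos_eq in H by apply Cmod_ge_0.
Qed.

Section ExceptionalSet.
Context (w : A11) (q : R) (z0 : C).
Hypothesis (Hz0 : unit_circle z0) (Hq : q < Cmod (A11_eval w z0)).

(** A point whose powers come close to [z0] cannot belong to [E], so by
    [circle_dirichlet] all elements of [E] are in a finite list of roots of
    unity. *)
Lemma E_set_finite :
  finite_set (E_set w q) /\ forall z, E_set w q z -> root_of_unity z.
Proof.
set (d := (Cmod (A11_eval w z0) - q) / 2).
pose proof (A11_norm_ge_0 w) as HS.
destruct (circle_dirichlet (d / (A11_norm w + 1))) as [L [HL Hdir]].
{ apply Rdiv_lt_0_compat; unfold d; lra. }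
assert (HEL : forall z, E_set w q z -> In z L).
{ intros z [Hz HE]. destruct (Hdir z Hz) as [u [Hu [->|Hn]]]; [exact Hu|exfalso].
  destruct (Hn z0 Hz0) as [n [Hn1 [Hn2 _]]].
  apply Rle_div_r in Hn2; [|lra].
  pose proof (A11_eval_near w z0 (z ^ n)%C (q + d) d Hz0 (unit_circle_pow z n Hz)).
  specialize (HE n Hn1). pose proof (Cmod_ge_0 (z ^ n - z0)%C).
  unfold d in *. nra. }
split; [|auto].
exists (filter (fun z => if excluded_middle_informative (E_set w q z)
                         then true else false) L).
intros z. rewrite filter_In.
destruct (excluded_middle_informative (E_set w q z)) as [HE|HE]; split.
- auto.
- auto.
- intros; contradiction.
- intros [_ H]. discriminate.
Qed.

(** If [mu] is not in [E], either its powers come close to [z0] after about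
    [1 / |mu - u|] steps, where [u] is a root of unity; this suffices if [u] is
    in [E] or if [u] is far from [mu]. Or [u] is close to [mu] and outside [E],
    and a power of [u] that violates the bound defining [E] gives one of [mu]. *)
Lemma E_set_escape : exists (C0 d : R), 0 < d /\
  forall mu, unit_circle mu -> ~ E_set w q mu ->
  exists n : nat, (1 <= n)%nat /\ q + d <= Cmod (A11_eval w (mu ^ n)%C) /\
    (INR n <= C0 \/ exists u, E_set w q u /\ INR n * Cmod (mu - u)%C <= C0).
Proof.
set (d1 := (Cmod (A11_eval w z0) - q) / 2).
pose proof (A11_norm_ge_0 w) as HS.
destruct (circle_dirichlet (d1 / (A11_norm w + 1))) as [L [HL Hdir]].
{ apply Rdiv_lt_0_compat; unfold d1; lra. }
destruct (E_set_compl_uniform w q L) as [C1 [d2 [Hd2 [HC1 Hunif]]]].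
set (k := d2 / 2 / ((A11_norm w + 1) * (C1 + 1))).
assert (Hk : 0 < k) by (apply Rdiv_lt_0_compat; nra).
exists (Rmax 9 (Rmax C1 (9 / k))), (Rmin d1 (d2 / 2)).
pose proof (Rmax_l 9 (Rmax C1 (9 / k))) as HA1.
pose proof (Rmax_r 9 (Rmax C1 (9 / k))) as HA2.
pose proof (Rmax_l C1 (9 / k)) as HA3. pose proof (Rmax_r C1 (9 / k)) as HA4.
pose proof (Rmin_l d1 (d2 / 2)) as HB1. pose proof (Rmin_r d1 (d2 / 2)) as HB2.
assert (Hd1 : 0 < d1) by (unfold d1; lra).
split; [apply Rmin_pos; lra|].
intros mu Hmu HmuE. destruct (Hdir mu Hmu) as [u [Hu Hcase]].
assert (Hu1 : unit_circle u) by apply root_of_unity_unit_circle, HL, Hu.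
destruct (classic (Cmod (mu - u)%C <= k /\ ~ E_set w q u)) as [[Hclose HuE]|Hfar].
- destruct (Hunif u Hu Hu1 HuE) as [n [Hn [HnC Hnw]]].
  exists n. split; [exact Hn|]. split; [|left; lra].
  apply Rle_trans with (q + d2 / 2); [lra|].
  apply A11_eval_near with (u ^ n)%C (d2 / 2); try (now apply unit_circle_pow).
  + lra.
  + pose proof (Cmod_pow_minus_le mu u n Hmu Hu1) as Hp.
    apply Rle_div_r in Hclose; [|nra].
    pose proof (Cmod_ge_0 (mu - u)%C) as Hc0.
    assert (INR n * Cmod (mu - u)%C <= (C1 + 1) * Cmod (mu - u)%C)
      by (apply Rmult_le_compat_r; lra).
    assert (A11_norm w * Cmod (mu ^ n - u ^ n)%C
      <= (A11_norm w + 1) * ((C1 + 1) * Cmod (mu - u)%C)).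
    { apply Rmult_le_compat; try lra. apply Cmod_ge_0. }
    lra.
- destruct Hcase as [->|Hwalk].
  { exfalso. apply Hfar. split; [|exact HmuE].
    replace (u - u)%C with (RtoC 0) by ring. rewrite Cmod_0. lra. }
  destruct (Hwalk z0 Hz0) as [n [Hn1 [Hn2 Hn3]]].
  apply Rle_div_r in Hn2; [|lra].
  exists n. split; [exact Hn1|]. split.
  + apply Rle_trans with (q + d1); [lra|].
    apply A11_eval_near with z0 d1; [exact Hz0|now apply unit_circle_pow| |].
    * unfold d1. lra.
    * pose proof (Cmod_ge_0 (mu ^ n - z0)%C). nra.
  + destruct (classic (E_set w q u)) as [HuE|HuE].
    * right. exists u. split; [exact HuE|lra].
    * left. assert (Hkd : k <= Cmod (mu - u)%C).
      { apply Rnot_lt_le. intros Hlt. apply Hfar. split; [lra|exact HuE]. }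
      apply Rle_trans with (9 / k); [|lra]. apply Rle_div_r; [exact Hk|].
      pose proof (pos_INR n). nra.
Qed.

End ExceptionalSet.

(** * Series of operators and resolvents *)

Definition bounded_by {X : NormedModule C_AbsRing} (A : X -> X) (b : R) : Prop :=
  forall x, norm (A x) <= b * norm x.

Lemma plus_minus_cancel {G : AbelianGroup} (a b : G) : plus (minus a b) b = a.
Proof. unfold minus. rewrite <- plus_assoc, plus_opp_l. apply plus_zero_r. Qed.

Lemma is_series_linear {U V : NormedModule C_AbsRing} (A : U -> V) (a : nat -> U) (l : U) :
  is_linear A -> is_series a l -> is_series (fun k => A (a k)) (A l).
Proof.
intros HA Ha. unfold is_series.
apply filterlim_ext with (fun n => A (sum_n a n)).
- intros n. induction n as [|n IH]; [now rewrite !sum_O|].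
  now rewrite !sum_Sn, <- IH, (linear_plus _ HA).
- eapply filterlim_comp; [exact Ha|]. apply (linear_cont A l HA).
Qed.

Lemma plus_eq_minus {G : AbelianGroup} (a b c d : G) :
  plus a b = plus c d -> minus b c = minus d a.
Proof.
intros H. unfold minus.
transitivity (plus (plus (opp a) (plus a b)) (opp c)).
- now rewrite plus_assoc, plus_opp_l, plus_zero_l.
- rewrite H, (plus_comm c d), (plus_comm (opp a)), <- !plus_assoc. f_equal.
  rewrite (plus_comm (opp a)), plus_assoc.
  transitivity (plus zero (opp a)); [|exact (plus_zero_l (opp a))].
  exact (f_equal (fun t => plus t (opp a)) (plus_opp_r c)).
Qed.

Section Resolvents.
Context {X : NormedModule C_AbsRing}.
Implicit Types (A B T : X -> X) (x y : X) (z : C).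

Lemma linear_scal_C A (z : C) x : is_linear A -> A (scal z x) = scal z (A x).
Proof. intros HA. exact (linear_scal A HA z x). Qed.

Lemma is_linear_scal_C (z : C) : is_linear (fun x : X => scal z x).
Proof. exact (@is_linear_scal_r C_AbsRing X z Cmult_comm). Qed.

Lemma is_linear_of_bounded A (b : R) :
  (forall x y, A (plus x y) = plus (A x) (A y)) ->
  (forall (c : C) x, A (scal c x) = scal c (A x)) ->
  bounded_by A b -> is_linear A.
Proof.
intros Hp Hs Hb. split; [exact Hp|exact Hs|].
exists (Rmax b 1). split; [pose proof (Rmax_r b 1); lra|].
intros x. eapply Rle_trans; [apply Hb|].
apply Rmult_le_compat_r; [apply norm_ge_0|apply Rmax_l].
Qed.

Lemma is_linear_plus_op A B : is_linear A -> is_linear B ->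
  is_linear (fun x => plus (A x) (B x)).
Proof.
intros HA HB. destruct (linear_norm _ HA) as [a [_ Ha]].
destruct (linear_norm _ HB) as [b [_ Hb]].
apply is_linear_of_bounded with (a + b).
- intros x y. rewrite (linear_plus _ HA), (linear_plus _ HB), <- !plus_assoc.
  f_equal. rewrite !plus_assoc. f_equal. apply plus_comm.
- intros c x. rewrite !linear_scal_C by assumption. symmetry. exact (scal_distr_l c (A x) (B x)).
- intros x. eapply Rle_trans; [apply norm_triangle|].
  specialize (Ha x). specialize (Hb x). lra.
Qed.

Lemma op_pow_comm A n x : op_pow A n (A x) = A (op_pow A n x).
Proof. exact (Nat.iter_swap n _ A x). Qed.

Lemma op_pow_S A n x : op_pow A (S n) x = A (op_pow A n x).
Proof. reflexivity. Qed.

Lemma op_pow_mult A n k x : op_pow (op_pow A n) k x = op_pow A (n * k) x.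
Proof.
induction k as [|k IH].
- now rewrite Nat.mul_0_r.
- rewrite Nat.mul_succ_r, Nat.add_comm. unfold op_pow at 3. rewrite Nat.iter_add.
  change (op_pow A n (op_pow (op_pow A n) k x) = op_pow A n (op_pow A (n * k) x)).
  now rewrite IH.
Qed.

Lemma is_series_eq (a : nat -> X) (l l' : X) :
  is_series a l -> is_series a l' -> l = l'.
Proof. intros H H'. exact (filterlim_locally_unique _ l l' H H'). Qed.

Lemma power_bounded_by T : is_linear T -> power_bounded T ->
  exists M, 0 <= M /\ forall n, bounded_by (op_pow T n) M.
Proof.
intros HT [M HM]. exists (Rmax M 0). split; [apply Rmax_r|]. intros n x.
eapply Rle_trans; [apply op_norm_ub, is_linear_op_pow, HT|].
apply Rmult_le_compat_r; [apply norm_ge_0|].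
eapply Rle_trans; [apply HM|apply Rmax_l].
Qed.

Lemma resolvent_unique A z B B' :
  is_resolvent A z B -> is_resolvent A z B' -> forall x, B x = B' x.
Proof.
intros [_ [HB _]] [_ [_ HB']] x. rewrite <- (HB' x) at 1. apply HB.
Qed.

Lemma resolvent_commutes A z B x : is_resolvent A z B -> A (B x) = B (A x).
Proof.
intros [HB [HB1 HB2]]. transitivity (minus (scal z (B x)) x).
- rewrite <- (HB2 x) at 3. symmetry. exact (minus_minus_cancel _ _).
- rewrite <- (HB1 x) at 2. rewrite (linear_minus _ _ _ HB), (linear_scal_C B) by exact HB.
  exact (minus_minus_cancel _ _).
Qed.

(** A factor of an invertible operator is invertible when the factors commute:
    if [(z - T) B = B (z - T) = a - A], then [B (a - A)^-1] inverts [z - T]. *)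
Lemma resolvent_of_factor T A B H (z a : C) :
  is_linear B -> is_resolvent A a H ->
  (forall x, minus (scal z (B x)) (T (B x)) = minus (scal a x) (A x)) ->
  (forall x, B (minus (scal z x) (T x)) = minus (scal a x) (A x)) ->
  is_resolvent T z (fun x => B (H x)).
Proof.
intros HB [HH [HH1 HH2]] H1 H2. split; [|split].
- exact (is_linear_comp H B HH HB).
- intros x.
  (* [H] commutes with [z - T] because its inverse [(z - T) B] does. *)
  assert (Hc : H (minus (scal z x) (T x))
    = minus (scal z (H x)) (T (H x))).
  { rewrite <- (HH1 (minus (scal z (H x)) (T (H x)))). f_equal.
    rewrite <- H1, H2, HH2. reflexivity. }
  rewrite Hc, H2. apply HH2.
- intros x. rewrite H1. apply HH2.
Qed.

Lemma resolvent_identity A B B' (z z' : C) x :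
  is_resolvent A z B -> is_resolvent A z' B' ->
  B x = plus (B' x) (scal (z' - z)%C (B (B' x))).
Proof.
intros [HB [HB1 _]] [_ [_ HB2]].
rewrite <- (HB2 x) at 1.
replace (minus (scal z' (B' x)) (A (B' x)))
  with (plus (minus (scal z (B' x)) (A (B' x))) (scal (z' - z)%C (B' x))).
- now rewrite (linear_plus _ HB), HB1, linear_scal_C.
- unfold minus. rewrite <- plus_assoc, (plus_comm (opp _)), plus_assoc. f_equal.
  etransitivity; [symmetry; exact (scal_distr_r z (z' - z)%C (B' x))|].
  f_equal. change (z + (z' - z) = z')%C. ring.
Qed.

End Resolvents.

Section OperatorSeries.
Context {Y : CompleteNormedModule C_AbsRing}.
Local Notation X := (CompleteNormedModule.NormedModule C_AbsRing Y).
Implicit Types (A B T : X -> X) (x y : X) (z : C).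

Lemma operator_series (D : nat -> X -> X) (b : nat -> R) (s : R) :
  (forall k, is_linear (D k)) -> (forall k, bounded_by (D k) (b k)) ->
  is_series b s ->
  exists W : X -> X, is_linear W /\ bounded_by W s /\
    forall x, is_series (fun k => D k x) (W x).
Proof.
intros HD Hb Hs.
assert (Hex : forall x, exists l, is_series (fun k => D k x) l).
{ intros x. apply (ex_series_le (V := Y) (fun k => D k x) (fun k => b k * norm x)).
  - intros k. apply Hb.
  - exists (s * norm x). now apply is_series_scal_r. }
pose (W := fun x => proj1_sig (constructive_indefinite_description _ (Hex x))).
assert (HW : forall x, is_series (fun k => D k x) (W x))
  by (intros x; exact (proj2_sig (constructive_indefinite_description _ (Hex x)))).
assert (HWb : bounded_by W s).
{ intros x. apply norm_is_series_le with (1 := HW x) (b := fun k => b k * norm x).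
  - now apply is_series_scal_r.
  - intros k. apply Hb. }
exists W. split; [|now split].
apply is_linear_of_bounded with s; [| |exact HWb].
- intros x y. apply is_series_eq with (fun k => D k (plus x y)); [apply HW|].
  apply is_series_ext with (fun k => plus (D k x) (D k y)).
  + intros k. now rewrite (linear_plus _ (HD k)).
  + exact (is_series_plus _ _ _ _ (HW x) (HW y)).
- intros c x. apply is_series_eq with (fun k => D k (scal c x)); [apply HW|].
  apply is_series_ext with (fun k => scal c (D k x)).
  + intros k. symmetry. now apply linear_scal_C.
  + exact (is_series_scal c _ _ (HW x)).
Qed.

Lemma is_series_Neumann_bound (M r a : R) : 0 <= r < a ->
  is_series (fun k => M * r ^ k / a ^ S k) (M / (a - r)).
Proof.
intros Hr.
apply is_series_ext with (fun k => M / a * (r / a) ^ k).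
- intros k. unfold Rdiv. rewrite Rpow_mult_distr, pow_inv. simpl. field. split; [apply pow_nonzero|]; lra.
- replace (M / (a - r)) with (M / a * (/ (1 - r / a))) by (field; lra).
  apply (is_series_scal (V := R_NormedModule) (M / a)).
  apply is_series_geom. rewrite Rabs_pos_eq.
  + apply Rlt_div_l; lra.
  + apply Rmult_le_pos; [lra|]. apply Rlt_le, Rinv_0_lt_compat. lra.
Qed.

(** The inverse is the Neumann series [sum_k A ^ k / z ^ (k + 1)]. *)
Lemma neumann A (M r : R) z : is_linear A ->
  (forall n, bounded_by (op_pow A n) (M * r ^ n)) -> 0 <= r < Cmod z ->
  exists B, is_resolvent A z B /\ bounded_by B (M / (Cmod z - r)).
Proof.
intros HA HM Hr.
assert (Hz : z <> 0%C) by (apply Cmod_gt_0; lra).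
destruct (operator_series (fun k x => scal (/ z ^ S k)%C (op_pow A k x))
  (fun k => M * r ^ k / Cmod z ^ S k) (M / (Cmod z - r))) as [B [HB [HBb HBs]]].
- intros k. apply (is_linear_comp (op_pow A k) (fun x => scal (/ z ^ S k)%C x)).
  + apply is_linear_op_pow, HA.
  + apply is_linear_scal_C.
- intros k x. rewrite norm_scal_C, Cmod_inv, Cmod_pow by now apply Cpow_nz.
  unfold Rdiv. rewrite (Rmult_comm (M * r ^ k)), Rmult_assoc.
  apply Rmult_le_compat_l; [|apply HM].
  apply Rlt_le, Rinv_0_lt_compat, pow_lt. lra.
- now apply is_series_Neumann_bound.
- (* Multiplying the series by [z] and dropping its first term [x] gives its
     termwise image under [A]. *)
  assert (Hshift : forall x, is_series (fun k => A (scal (/ z ^ S k)%C (op_pow A k x)))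
    (minus (scal z (B x)) x)).
  { intros x.
    apply is_series_ext with (fun k => scal z (scal (/ z ^ S (S k))%C (op_pow A (S k) x))).
    - intros k. rewrite (linear_scal_C A) by exact HA.
      etransitivity; [exact (scal_assoc z (/ z ^ S (S k))%C (op_pow A (S k) x))|].
      f_equal. change (z * / z ^ S (S k) = / z ^ S k)%C.
      rewrite (Cpow_S z (S k)). field. split; [now apply Cpow_nz|exact Hz].
    - apply (is_series_incr_1 (fun k => scal z (scal (/ z ^ S k)%C (op_pow A k x)))).
      replace (plus _ _) with (scal z (B x)).
      + exact (is_series_scal z _ _ (HBs x)).
      + replace (scal z (scal (/ z ^ 1)%C (op_pow A 0 x))) with x.
        * symmetry. exact (plus_minus_cancel (scal z (B x)) x).
        * symmetry. etransitivity; [exact (scal_assoc z (/ z ^ 1)%C x)|].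
          replace (mult z (/ z ^ 1)%C) with (one : C_AbsRing); [apply scal_one|].
          change (RtoC 1 = z * / z ^ 1)%C. rewrite Cpow_1_r. field. exact Hz. }
  exists B. split; [split; [exact HB|split]|exact HBb].
  + intros x. rewrite (linear_minus _ _ _ HB), (linear_scal_C B) by exact HB.
    replace (B (A x)) with (minus (scal z (B x)) x).
    * apply minus_minus_cancel.
    * apply is_series_eq with (1 := Hshift x).
      apply is_series_ext with (2 := HBs (A x)).
      intros k. rewrite op_pow_comm, (linear_scal_C A) by exact HA. reflexivity.
  + intros x. replace (A (B x)) with (minus (scal z (B x)) x).
    * apply minus_minus_cancel.
    * apply is_series_eq with (1 := Hshift x).
      exact (is_series_linear A _ _ HA (HBs x)).
Qed.

Lemma resolvent_of_contraction A (r : R) z : is_linear A -> bounded_by A r ->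
  0 <= r < Cmod z ->
  exists B, is_resolvent A z B /\ bounded_by B (/ (Cmod z - r)).
Proof.
intros HA Hb Hr. rewrite <- (Rmult_1_l (/ _)). apply neumann; [exact HA| |exact Hr].
intros n. induction n as [|n IH]; intros x.
- simpl. rewrite !Rmult_1_l. lra.
- change (op_pow A (S n) x) with (A (op_pow A n x)).
  eapply Rle_trans; [apply Hb|]. simpl. specialize (IH x). nra.
Qed.

Lemma resolvent_of_power_bounded T (M : R) z : is_linear T ->
  (forall n, bounded_by (op_pow T n) M) -> 1 < Cmod z ->
  exists B, is_resolvent T z B /\ bounded_by B (M / (Cmod z - 1)).
Proof.
intros HT HM Hz. apply neumann; [exact HT| |lra].
intros n. rewrite pow1, Rmult_1_r. apply HM.
Qed.

(** If [B] inverts [z - T], then [(z' - T) B = 1 - (z - z') B], which a Neumann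
    series inverts. *)
Lemma resolvent_perturbation T B (b : R) (z z' : C) :
  is_resolvent T z B -> bounded_by B b -> 0 <= b ->
  Cmod (z' - z)%C * b < 1 -> exists B', is_resolvent T z' B'.
Proof.
intros HR Hb Hb0 Hz. pose proof HR as [HB [HB1 HB2]].
destruct (resolvent_of_contraction (fun x => scal (z - z')%C (B x))
  (Cmod (z' - z)%C * b) 1%C) as [H [HH _]].
- apply (is_linear_comp B (fun x => scal (z - z')%C x)); [exact HB|apply is_linear_scal_C].
- intros x. rewrite norm_scal_C, Rmult_assoc.
  replace (Cmod (z - z')%C) with (Cmod (z' - z)%C).
  + apply Rmult_le_compat_l; [apply Cmod_ge_0|apply Hb].
  + rewrite <- Cmod_opp. f_equal. ring.
- rewrite Cmod_1. split; [|exact Hz]. apply Rmult_le_pos; [apply Cmod_ge_0|exact Hb0].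
- exists (fun x => B (H x)).
  assert (Hid : forall x, minus (scal z' (B x)) (T (B x))
    = minus (scal (RtoC 1) x) (scal (z - z')%C (B x))).
  { intros x. replace (scal (RtoC 1) x) with x by (symmetry; exact (scal_one x)).
    rewrite <- (HB2 x) at 3. unfold minus. rewrite <- plus_assoc, (plus_comm (opp (T _))), plus_assoc.
    f_equal.
    transitivity (plus (scal z (B x)) (scal (- (z - z'))%C (B x))).
    - etransitivity; [|exact (scal_distr_r z (- (z - z'))%C (B x))].
      f_equal. change (z' = z + - (z - z'))%C. ring.
    - f_equal. exact (scal_opp_l (z - z')%C (B x)). }
  apply resolvent_of_factor with (1 := HB) (2 := HH); [exact Hid|].
  intros x. rewrite <- Hid.
  rewrite (linear_minus _ _ _ HB), (linear_scal_C B) by exact HB.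
  now rewrite (resolvent_commutes T z B x HR).
Qed.

End OperatorSeries.

(** * Factoring [w(z ^ n) - w(T ^ n)] through [z - T] *)

Section DifferenceQuotients.
Context {X : NormedModule C_AbsRing}.
Implicit Types (T : X -> X) (x : X) (z : C).

Lemma is_linear_scal_vector x : is_linear (U := C_NormedModule) (fun c : C => scal c x).
Proof.
split.
- intros a b. exact (scal_distr_r a b x).
- intros a b. symmetry. exact (scal_assoc a b x).
- exists (norm x + 1). pose proof (norm_ge_0 x). split; [lra|].
  intros c. rewrite norm_scal_C. change (norm c) with (Cmod c).
  pose proof (Cmod_ge_0 c). nra.
Qed.

(** The operator [sum_(j < m) z ^ (m - 1 - j) T ^ j]. *)
Fixpoint diff_quot T z (m : nat) x : X :=
  match m with
  | O => zero
  | S m => plus (op_pow T m x) (scal z (diff_quot T z m x))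
  end.

Lemma is_linear_diff_quot T z m : is_linear T -> is_linear (diff_quot T z m).
Proof.
intros HT. induction m as [|m IH]; [apply is_linear_zero|].
apply (is_linear_plus_op (op_pow T m) (fun x => scal z (diff_quot T z m x))).
- now apply is_linear_op_pow.
- apply (is_linear_comp (diff_quot T z m) (fun x => scal z x)); [exact IH|].
  apply is_linear_scal_C.
Qed.

Lemma diff_quot_bound T z m (M : R) : unit_circle z ->
  (forall n, bounded_by (op_pow T n) M) -> bounded_by (diff_quot T z m) (INR m * M).
Proof.
intros Hz HM. induction m as [|m IH]; intros x.
- simpl. rewrite norm_zero. lra.
- rewrite S_INR. simpl diff_quot. eapply Rle_trans; [apply norm_triangle|].
  rewrite norm_scal_C, Hz. specialize (HM m x). specialize (IH x). lra.
Qed.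

Lemma diff_quot_S_l T z m x : is_linear T ->
  diff_quot T z (S m) x = plus (T (diff_quot T z m x)) (scal (z ^ m)%C x).
Proof.
intros HT. induction m as [|m IH].
- simpl. rewrite (linear_zero _ HT), plus_zero_l.
  transitivity x; [|symmetry; exact (scal_one x)].
  transitivity (plus x zero); [f_equal; exact (scal_zero_r z)|exact (plus_zero_r x)].
- change (diff_quot T z (S (S m)) x)
    with (plus (op_pow T (S m) x) (scal z (diff_quot T z (S m) x))).
  rewrite IH at 1. simpl diff_quot. rewrite (linear_plus _ HT), (linear_scal_C T) by exact HT.
  rewrite op_pow_S, <- plus_assoc. f_equal.
  etransitivity; [exact (scal_distr_l z _ _)|]. f_equal. exact (scal_assoc z (z ^ m)%C x).
Qed.

Lemma diff_quot_comm T z m x : is_linear T ->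
  T (diff_quot T z m x) = diff_quot T z m (T x).
Proof.
intros HT. induction m as [|m IH]; [exact (linear_zero _ HT)|].
simpl. now rewrite (linear_plus _ HT), (linear_scal_C T), IH, op_pow_comm.
Qed.

Lemma diff_quot_factor T z m x : is_linear T ->
  minus (scal z (diff_quot T z m x)) (T (diff_quot T z m x))
  = minus (scal (z ^ m)%C x) (op_pow T m x).
Proof.
intros HT. apply plus_eq_minus. exact (diff_quot_S_l T z m x HT).
Qed.

End DifferenceQuotients.

Section Calculus.
Context {Y : CompleteNormedModule C_AbsRing}.
Local Notation X := (CompleteNormedModule.NormedModule C_AbsRing Y).
Implicit Types (T B : X -> X) (x : X) (z : C).

Lemma power_bounded_op_pow T (M : R) n : is_linear T ->
  (forall k, bounded_by (op_pow T k) M) -> 0 <= M -> power_bounded (op_pow T n).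
Proof.
intros HT HM HM0. exists M. intros k. apply op_norm_le; [|exact HM0|].
- now apply is_linear_op_pow, is_linear_op_pow.
- intros x. rewrite op_pow_mult. apply HM.
Qed.

Lemma is_series_op_series (c : nat -> C) T B x : is_linear T ->
  is_op_series c T B -> is_series (fun k => scal (c k) (op_pow T k x)) (B x).
Proof.
intros HT [HB Hlim].
assert (Hn : is_lim_seq (fun n => norm (minus
  (sum_n (fun k => scal (c k) (op_pow T k x)) n) (B x))) 0).
{ apply is_lim_seq_le_le with (u := fun _ => 0) (w := fun n => op_norm (fun x : X =>
    minus (sum_n (fun k : nat => scal (c k) (op_pow T k x)) n) (B x)) * norm x).
  - intros n. split; [apply norm_ge_0|].
    apply (op_norm_ub (fun x : X =>
      minus (sum_n (fun k : nat => scal (c k) (op_pow T k x)) n) (B x)) x).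
    apply is_linear_minus_op; [now apply is_linear_sum_op|exact HB].
  - apply is_lim_seq_const.
  - replace (Finite 0) with (Finite (0 * norm x)) by (f_equal; ring).
    apply is_lim_seq_mult'; [exact Hlim|apply is_lim_seq_const]. }
apply filterlim_locally_ball_norm. intros eps.
apply is_lim_seq_spec in Hn. destruct (Hn eps) as [N HN]. exists N. intros n Hn'.
specialize (HN n Hn'). rewrite Rminus_0_r, Rabs_pos_eq in HN by apply norm_ge_0.
exact HN.
Qed.

(** Each [z ^ (n k) - T ^ (n k)] is divisible by [z - T], with a quotient of
    norm at most [n k M]; the weight [k + 1] in the norm of the algebra is what
    makes the sum of these quotients converge. *)
Lemma calculus_factor T (M : R) (w : A11) z n : is_linear T -> 0 <= M ->
  (forall k, bounded_by (op_pow T k) M) -> unit_circle z ->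
  exists B, is_linear B /\ bounded_by B (INR n * (M * A11_norm w)) /\
    (forall x, minus (scal z (B x)) (T (B x))
      = minus (scal (A11_eval w (z ^ n)%C) x) (A11_op w (op_pow T n) x)) /\
    (forall x, B (minus (scal z x) (T x))
      = minus (scal (A11_eval w (z ^ n)%C) x) (A11_op w (op_pow T n) x)).
Proof.
intros HT HM0 HM Hz.
destruct (operator_series (fun k x => scal (w k) (diff_quot T z (n * k) x))
  (fun k => INR n * M * (INR (k + 1) * Cmod (w k))) (INR n * (M * A11_norm w)))
  as [B [HB [HBb HBs]]].
- intros k. apply (is_linear_comp (diff_quot T z (n * k)) (fun x => scal (w k) x)).
  + now apply is_linear_diff_quot.
  + apply is_linear_scal_C.
- intros k x. rewrite norm_scal_C.
  eapply Rle_trans.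
  + apply Rmult_le_compat_l; [apply Cmod_ge_0|].
    apply (diff_quot_bound T z (n * k) M Hz HM).
  + rewrite mult_INR, plus_INR. simpl (INR 1).
    pose proof (pos_INR n). pose proof (norm_ge_0 x). pose proof (Cmod_ge_0 (w k)).
    assert (0 <= INR n * M * Cmod (w k) * norm x)
      by (repeat apply Rmult_le_pos; assumption).
    lra.
- replace (INR n * (M * A11_norm w)) with (INR n * M * A11_norm w) by ring.
  apply (is_series_scal (V := R_NormedModule) (INR n * M)), is_series_A11_norm.
- assert (Hfac : forall x, minus (scal z (B x)) (T (B x))
      = minus (scal (A11_eval w (z ^ n)%C) x) (A11_op w (op_pow T n) x)).
  { intros x.
    apply is_series_eq with
      (fun k => scal (w k) (minus (scal ((z ^ n) ^ k)%C x) (op_pow (op_pow T n) k x))).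
    - apply is_series_ext with (fun k => minus (scal z (scal (w k) (diff_quot T z (n * k) x)))
        (T (scal (w k) (diff_quot T z (n * k) x)))).
      + intros k. rewrite (linear_scal_C T) by exact HT.
        rewrite <- Cpow_mult_r, op_pow_mult, <- diff_quot_factor by exact HT.
        rewrite scal_minus_distr_l. f_equal.
        etransitivity; [exact (scal_assoc z (w k) _)|].
        etransitivity; [|symmetry; exact (scal_assoc (w k) z _)].
        f_equal. apply Cmult_comm.
      + apply (is_series_linear (fun y => minus (scal z y) (T y))); [|apply HBs].
        apply is_linear_minus_op; [apply is_linear_scal_C|exact HT].
    - apply is_series_ext with (fun k => plus (scal (w k * (z ^ n) ^ k)%C x)
        (opp (scal (w k) (op_pow (op_pow T n) k x)))).
      + intros k. rewrite scal_minus_distr_l. unfold minus. f_equal.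
        symmetry. exact (scal_assoc (w k) ((z ^ n) ^ k)%C x).
      + apply (is_series_minus (fun k => scal (w k * (z ^ n) ^ k)%C x)).
        * apply (is_series_linear (U := C_NormedModule) (fun c => scal c x)).
          -- apply is_linear_scal_vector.
          -- now apply is_series_A11_eval, unit_circle_pow.
        * apply is_series_op_series; [now apply is_linear_op_pow|].
          apply (@A11_op_correct Y); [now apply is_linear_op_pow|].
          now apply power_bounded_op_pow with M. }
  exists B. split; [exact HB|]. split; [exact HBb|]. split; [exact Hfac|].
  intros x. rewrite <- Hfac, (linear_minus _ _ _ HB), (linear_scal_C B) by exact HB.
  f_equal. apply is_series_eq with (fun k => scal (w k) (diff_quot T z (n * k) (T x))).
  + apply HBs.
  + apply is_series_ext with (fun k => T (scal (w k) (diff_quot T z (n * k) x))).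
    * intros k. now rewrite (linear_scal_C T), diff_quot_comm by exact HT.
    * apply is_series_linear; [exact HT|apply HBs].
Qed.

(** Where [|w(z ^ n)| > q], the operator [w(z ^ n) - w(T ^ n)] is invertible,
    hence so is its factor [mu - T]. *)
Lemma resolvent_on_circle T (M : R) (w : A11) (q d : R) z n :
  is_linear T -> 0 <= M -> (forall k, bounded_by (op_pow T k) M) ->
  op_norm (A11_op w (op_pow T n)) <= q -> unit_circle z -> 0 < d ->
  q + d <= Cmod (A11_eval w (z ^ n)%C) ->
  exists B, is_resolvent T z B /\ bounded_by B (INR n * (M * A11_norm w / d)).
Proof.
intros HT HM0 HM Hq Hz Hd Hw.
assert (HW : is_linear (A11_op w (op_pow T n))).
{ apply (@A11_op_correct Y); [now apply is_linear_op_pow|].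
  now apply power_bounded_op_pow with M. }
assert (Hq0 : 0 <= q).
{ eapply Rle_trans; [apply (op_norm_ge_0 _ HW)|exact Hq]. }
destruct (resolvent_of_contraction (A11_op w (op_pow T n)) q (A11_eval w (z ^ n)%C))
  as [H [HH HHb]]; [exact HW| |lra|].
{ intros x. eapply Rle_trans; [apply (op_norm_ub _ x HW)|].
  apply Rmult_le_compat_r; [apply norm_ge_0|exact Hq]. }
destruct (calculus_factor T M w z n HT HM0 HM Hz) as [B [HB [HBb [HB1 HB2]]]].
exists (fun x => B (H x)). split.
- now apply resolvent_of_factor with (2 := HH).
- intros x. eapply Rle_trans; [apply HBb|].
  replace (INR n * (M * A11_norm w / d) * norm x)
    with (INR n * (M * A11_norm w) * (/ d * norm x)) by (field; lra).
  apply Rmult_le_compat_l.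
  + pose proof (pos_INR n). pose proof (A11_norm_ge_0 w).
    repeat apply Rmult_le_pos; assumption.
  + eapply Rle_trans; [apply HHb|]. apply Rmult_le_compat_r; [apply norm_ge_0|].
    apply Rinv_le_contravar; lra.
Qed.

End Calculus.

(** * From resolvent bounds on the circle to the Ritt condition *)

Lemma unit_circle_retraction (z : C) : z <> 0%C ->
  exists mu, unit_circle mu /\ Cmod (z - mu)%C = Rabs (Cmod z - 1).
Proof.
intros Hz. pose proof (proj1 (Cmod_gt_0 z) Hz) as Hm.
assert (Hi : Cmod (RtoC (/ Cmod z)) = / Cmod z).
{ rewrite Cmod_R. apply Rabs_pos_eq, Rlt_le, Rinv_0_lt_compat, Hm. }
exists (z * RtoC (/ Cmod z))%C. split.
- unfold unit_circle. rewrite Cmod_mult, Hi. field. lra.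
- replace (z - z * RtoC (/ Cmod z))%C with (z * RtoC (1 - / Cmod z))%C
    by (rewrite RtoC_minus; ring).
  rewrite Cmod_mult, Cmod_R, <- (Rabs_pos_eq (Cmod z)) at 1 by lra.
  rewrite <- Rabs_mult. f_equal. field. lra.
Qed.

Section RittFromCircle.
Context {Y : CompleteNormedModule C_AbsRing}.
Local Notation X := (CompleteNormedModule.NormedModule C_AbsRing Y).
Context (T : X -> X) (M : R).
Hypothesis (HT : is_linear T) (HM0 : 0 <= M)
  (HM : forall n, bounded_by (op_pow T n) M).

Lemma spectrum_in_disc (z : C) : spectrum T z -> Cmod z <= 1.
Proof.
intros Hz. apply Rnot_lt_le. intros Hlt. apply Hz.
destruct (resolvent_of_power_bounded T M z HT HM Hlt) as [B [HB _]]. eauto.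
Qed.

Lemma resolvent_exterior_norm (z : C) (B : X -> X) :
  1 < Cmod z -> is_resolvent T z B -> (Cmod z - 1) * op_norm B <= M.
Proof.
intros Hz HB.
destruct (resolvent_of_power_bounded T M z HT HM Hz) as [B' [HB' Hb]].
assert (H : op_norm B <= M / (Cmod z - 1)).
{ apply op_norm_le; [apply HB| |].
  - apply Rmult_le_pos; [exact HM0|]. apply Rlt_le, Rinv_0_lt_compat. lra.
  - intros x. rewrite (resolvent_unique T z B B' HB HB'). apply Hb. }
apply Rle_div_r in H; lra.
Qed.

(** For [|z| > 1] and [mu = z / |z|], the resolvent identity and
    [|z - mu| |R(z)| = (|z| - 1) |R(z)| <= M] give
    [|R(z)| <= (1 + M) |R(mu)|]. *)
Lemma ritt_from_circle (F : C -> Prop) (K : R) : 0 <= K ->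
  (forall mu, unit_circle mu -> F mu \/ exists B, is_resolvent T mu B /\
    exists u, F u /\ op_norm B * Cmod (mu - u)%C <= K) ->
  forall (z : C) (B : X -> X), 1 < Cmod z -> is_resolvent T z B ->
  exists u, F u /\ Cmod (z - u)%C * op_norm B <= M + (1 + M) * K.
Proof.
intros HK0 HK z B Hz HB.
pose proof (resolvent_exterior_norm z B Hz HB) as Hext.
pose proof (op_norm_ge_0 B (proj1 HB)) as HB0.
destruct (unit_circle_retraction z) as [mu [Hmu Hd]]; [apply Cmod_gt_0; lra|].
rewrite Rabs_pos_eq in Hd by lra.
destruct (HK mu Hmu) as [HF|[B0 [HB0r [u [Hu HuK]]]]].
- exists mu. split; [exact HF|]. rewrite Hd. nra.
- exists u. split; [exact Hu|].
  pose proof (op_norm_ge_0 B0 (proj1 HB0r)) as HB00.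
  assert (Hle : op_norm B <= (1 + M) * op_norm B0).
  { apply op_norm_le; [apply HB|nra|]. intros x.
    rewrite (resolvent_identity T B B0 z mu x HB HB0r).
    eapply Rle_trans; [apply (norm_triangle (B0 x) (scal (mu - z)%C (B (B0 x))))|].
    rewrite norm_scal_C.
    replace (Cmod (mu - z)%C) with (Cmod z - 1)
      by (rewrite <- Hd, <- Cmod_opp; f_equal; ring).
    pose proof (op_norm_ub B0 x (proj1 HB0r)) as H0.
    assert (H1 : (Cmod z - 1) * norm (B (B0 x)) <= M * norm (B0 x)).
    { apply Rle_trans with ((Cmod z - 1) * (op_norm B * norm (B0 x))).
      - apply Rmult_le_compat_l; [lra|]. apply (op_norm_ub B (B0 x) (proj1 HB)).
      - rewrite <- Rmult_assoc. apply Rmult_le_compat_r; [apply norm_ge_0|exact Hext]. }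
    apply Rle_trans with ((1 + M) * norm (B0 x)); [lra|].
    rewrite Rmult_assoc. apply Rmult_le_compat_l; lra. }
  assert (Htri : Cmod (z - u)%C <= (Cmod z - 1) + Cmod (mu - u)%C).
  { rewrite <- Hd. replace (z - u)%C with ((z - mu) + (mu - u))%C by ring.
    apply Cmod_triangle. }
  pose proof (Cmod_ge_0 (mu - u)%C) as Hc.
  apply Rle_trans with ((Cmod z - 1) * op_norm B + Cmod (mu - u)%C * op_norm B); [nra|].
  apply Rplus_le_compat; [exact Hext|].
  apply Rle_trans with (Cmod (mu - u)%C * ((1 + M) * op_norm B0)).
  + now apply Rmult_le_compat_l.
  + replace (Cmod (mu - u)%C * ((1 + M) * op_norm B0))
      with ((1 + M) * (op_norm B0 * Cmod (mu - u)%C)) by ring.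
    apply Rmult_le_compat_l; lra.
Qed.

(** The spectrum is at distance at least [1 / |R(mu)|] from [mu], so a uniform
    bound on the circle leaves an annulus free of spectrum. *)
Lemma spectral_radius_lt_1 (K : R) : 0 <= K ->
  (forall mu, unit_circle mu -> exists B, is_resolvent T mu B /\ op_norm B <= K) ->
  spectral_radius T < 1.
Proof.
intros HK0 HK. set (e := / (2 * (K + 1))).
assert (He : 0 < e) by (apply Rinv_0_lt_compat; lra).
assert (He1 : e * (2 * (K + 1)) = 1) by (apply Rinv_l; lra).
assert (Hsp : forall z, spectrum T z -> Cmod z <= 1 - e).
{ intros z Hz. pose proof (spectrum_in_disc z Hz) as H1.
  apply Rnot_lt_le. intros Hlt. apply Hz.
  destruct (unit_circle_retraction z) as [mu [Hmu Hd]]; [apply Cmod_gt_0; nra|].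
  destruct (HK mu Hmu) as [B [HB HBK]].
  apply (resolvent_perturbation T B K mu z HB); [|exact HK0|].
  - intros x. eapply Rle_trans; [apply (op_norm_ub B x (proj1 HB))|].
    apply Rmult_le_compat_r; [apply norm_ge_0|exact HBK].
  - rewrite Hd, Rabs_left1 by lra. nra. }
unfold spectral_radius.
pose proof (Lub_Rbar_correct (fun r => exists z : C, spectrum T z /\ r = Cmod z)) as Hl.
assert (Hub : Rbar_le (Lub_Rbar (fun r => exists z : C, spectrum T z /\ r = Cmod z))
  (1 - e)).
{ apply (proj2 Hl). intros r [z [Hz ->]]. apply Hsp, Hz. }
destruct (Lub_Rbar _) as [l| |]; simpl in *; lra.
Qed.

End RittFromCircle.

(** * The resolvent of a power *)

Lemma linear_sum_n {U V : NormedModule C_AbsRing} (A : U -> V) (f : nat -> U) n :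
  is_linear A -> A (sum_n f n) = sum_n (fun l => A (f l)) n.
Proof.
intros HA. induction n as [|n IH]; [now rewrite !sum_O|].
now rewrite !sum_Sn, (linear_plus _ HA), IH.
Qed.

Lemma cis_neq_1 (t : R) : 0 < t < 2 * PI -> cis t <> 1%C.
Proof.
intros Ht H. apply (f_equal fst) in H. simpl in H.
replace t with (2 * (t / 2)) in H by field. rewrite cos_2a_sin in H.
pose proof (sin_gt_0 (t / 2)). nra.
Qed.

Lemma sum_powers_root_of_unity (N j : nat) : (1 <= j <= N)%nat ->
  sum_n (G := C_AbelianMonoid) (fun l => cis (2 * PI / INR (S N)) ^ (l * j))%C N = RtoC 0.
Proof.
intros Hj. set (z := (cis (2 * PI / INR (S N)) ^ j)%C).
assert (HN : 0 < INR (S N)) by (apply lt_0_INR; lia).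
assert (Hz : (z ^ S N = 1)%C).
{ unfold z. rewrite <- Cpow_mult_r, cis_pow, mult_INR, INR_IZR_INZ.
  rewrite <- (cis_period_Z (Z.of_nat j)). f_equal. field. lra. }
assert (Hz1 : z <> 1%C).
{ unfold z. rewrite cis_pow. apply cis_neq_1.
  pose proof PI_RGT_0. assert (0 < INR j < INR (S N)) by (split; [apply lt_0_INR|apply lt_INR]; lia).
  replace (INR j * (2 * PI / INR (S N))) with (2 * PI * (INR j / INR (S N))) by (field; lra).
  assert (0 < INR j / INR (S N) < 1).
  { split; [apply Rdiv_lt_0_compat|apply Rlt_div_l]; lra. }
  nra. }
assert (Hgeom : forall n, ((z - 1) * sum_n (G := C_AbelianMonoid)
  (fun l => cis (2 * PI / INR (S N)) ^ (l * j)) n = z ^ S n - 1)%C).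
{ intros n. induction n as [|n IH].
  - rewrite sum_O, Nat.mul_0_l, Cpow_1_r. simpl. ring.
  - rewrite sum_Sn. change plus with Cplus.
    rewrite Cmult_plus_distr_l, IH, (Nat.mul_comm (S n)), Cpow_mult_r.
    fold z. rewrite (Cpow_S z (S n)). ring. }
specialize (Hgeom N). rewrite Hz in Hgeom.
replace (1 - 1)%C with (RtoC 0) in Hgeom by ring.
destruct (Ceq_dec (sum_n (G := C_AbelianMonoid)
  (fun l => cis (2 * PI / INR (S N)) ^ (l * j))%C N) 0) as [H|H]; [exact H|].
exfalso. apply (Cmult_neq_0 (z - 1) _) in Hgeom; [exact Hgeom| |exact H].
intros H1. apply Hz1. replace z with ((z - 1) + 1)%C by ring. rewrite H1. ring.
Qed.

Lemma roots_of_unit (N : nat) (mu : C) : unit_circle mu ->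
  exists nu : nat -> C, (forall l, (nu l ^ S N)%C = mu) /\
    forall a, (1 <= a <= N)%nat ->
      sum_n (G := C_AbelianMonoid) (fun l => nu l ^ a)%C N = RtoC 0.
Proof.
intros Hmu. destruct (unit_circle_angle mu Hmu) as [t [-> _]].
assert (HN : 0 < INR (S N)) by (apply lt_0_INR; lia).
exists (fun l => cis (t / INR (S N)) * cis (2 * PI / INR (S N)) ^ l)%C. split.
- intros l. rewrite Cpow_mult_l, <- Cpow_mult_r, !cis_pow, mult_INR, <- cis_plus.
  rewrite <- (Cmult_1_r (cis t)), <- (cis_period_Z (Z.of_nat l)), <- INR_IZR_INZ, <- cis_plus.
  f_equal. field. lra.
- intros a Ha.
  rewrite (sum_n_ext _ (fun l => scal (cis (t / INR (S N)) ^ a)%C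
    (cis (2 * PI / INR (S N)) ^ (l * a))%C : C_ModuleSpace)).
  + etransitivity; [exact (sum_n_scal_l (V := C_ModuleSpace) _ _ _)|].
    etransitivity; [apply f_equal; exact (sum_powers_root_of_unity N a Ha)|].
    exact (Cmult_0_r _).
  + intros l. rewrite Cpow_mult_l, <- Cpow_mult_r. reflexivity.
Qed.

Section PowerResolvent.
Context {Y : CompleteNormedModule C_AbsRing}.
Local Notation X := (CompleteNormedModule.NormedModule C_AbsRing Y).
Context (T : X -> X).
Hypothesis (HT : is_linear T).

Lemma diff_quot_factor_r (z : C) (m : nat) (x : X) :
  diff_quot T z m (minus (scal z x) (T x))
  = minus (scal (z ^ m)%C x) (op_pow T m x).
Proof.
pose proof (is_linear_diff_quot T z m HT) as HD.
rewrite (linear_minus _ _ _ HD), (linear_scal_C (diff_quot T z m)) by exact HD.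
rewrite <- diff_quot_comm by exact HT. now apply diff_quot_factor.
Qed.

Section Roots.
Context (N : nat) (mu : C) (nu : nat -> C).
Hypothesis (Hnu : forall l, (nu l ^ S N)%C = mu)
  (Hsum : forall a, (1 <= a <= N)%nat ->
    sum_n (G := C_AbelianMonoid) (fun l => nu l ^ a)%C N = RtoC 0).

(** The exponents of [nu l] that occur lie between [a] and [a + m - 1], where
    the power sums vanish. *)
Lemma sum_diff_quot_zero (m : nat) (x : X) : forall a, (1 <= a)%nat -> (a + m <= S N)%nat ->
  sum_n (fun l => scal (nu l ^ a)%C (diff_quot T (nu l) m x)) N = zero.
Proof.
induction m as [|m IH]; intros a Ha Ham.
- rewrite (sum_n_ext _ (fun _ => zero)).
  + apply sum_n_m_const_zero.
  + intros l. exact (scal_zero_r (nu l ^ a)%C).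
- rewrite (sum_n_ext _ (fun l => plus (scal (nu l ^ a)%C (op_pow T m x))
    (scal (nu l ^ S a)%C (diff_quot T (nu l) m x)))).
  + rewrite sum_n_plus, IH by lia.
    rewrite <- (linear_sum_n (U := C_NormedModule) (fun c => scal c (op_pow T m x)))
      by apply is_linear_scal_vector.
    transitivity (plus (scal (RtoC 0) (op_pow T m x)) zero).
    * f_equal. f_equal. apply Hsum. lia.
    * etransitivity; [exact (plus_zero_r _)|]. exact (scal_zero_l (op_pow T m x)).
  + intros l. simpl diff_quot. etransitivity; [exact (scal_distr_l (nu l ^ a)%C _ _)|].
    f_equal. etransitivity; [exact (scal_assoc (nu l ^ a)%C (nu l) _)|].
    f_equal. change (nu l ^ a * nu l = nu l ^ S a)%C. rewrite Cpow_S. ring.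
Qed.

Lemma sum_diff_quot (x : X) :
  sum_n (fun l => scal (nu l) (diff_quot T (nu l) (S N) x)) N
  = scal (RtoC (INR (S N)) * mu)%C x.
Proof.
rewrite (sum_n_ext _ (fun l => plus
  (T (scal (nu l ^ 1)%C (diff_quot T (nu l) N x))) (scal mu x))).
- rewrite sum_n_plus, <- (linear_sum_n T), (sum_diff_quot_zero N) by (exact HT || lia).
  etransitivity; [exact (f_equal (fun y => plus y (sum_n (fun _ => scal mu x) N))
    (linear_zero T HT))|].
  etransitivity; [exact (plus_zero_l _)|].
  assert (H : forall n, sum_n (fun _ => scal mu x) n = scal (RtoC (INR (S n)) * mu)%C x).
  { intros n. induction n as [|n IH].
    - rewrite sum_O. simpl INR. now rewrite Cmult_1_l.
    - rewrite sum_Sn, IH, (S_INR (S n)), RtoC_plus, Cmult_plus_distr_r, Cmult_1_l.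
      symmetry. exact (scal_distr_r (RtoC (INR (S n)) * mu)%C mu x). }
  apply H.
- intros l. rewrite diff_quot_S_l, Cpow_1_r, (linear_scal_C T) by exact HT.
  etransitivity; [exact (scal_distr_l (nu l) _ _)|]. f_equal.
  etransitivity; [exact (scal_assoc (nu l) (nu l ^ N)%C x)|].
  f_equal. change (nu l * nu l ^ N = mu)%C. now rewrite <- Cpow_S.
Qed.

End Roots.

Lemma is_linear_sum_n (A : nat -> X -> X) n : (forall l, is_linear (A l)) ->
  is_linear (fun x => sum_n (fun l => A l x) n).
Proof.
intros HA. induction n as [|n IH].
- apply is_linear_ext with (2 := HA 0%nat). intros x. now rewrite sum_O.
- apply is_linear_ext with (fun x => plus (sum_n (fun l => A l x) n) (A (S n) x)).
  + intros x. now rewrite sum_Sn.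
  + apply (is_linear_plus_op (fun x => sum_n (fun l => A l x) n) (A (S n))); auto.
Qed.

(** The partial fraction decomposition
    [1 / (mu - t ^ N) = sum_(nu ^ N = mu) nu / (N mu) * 1 / (nu - t)]
    shows that the resolvent of the power is an average of resolvents. *)
Lemma resolvent_op_pow (N : nat) (mu : C) (K : R) :
  (1 <= N)%nat -> unit_circle mu -> 0 <= K ->
  (forall nu, unit_circle nu -> (nu ^ N)%C = mu ->
    exists B, is_resolvent T nu B /\ op_norm B <= K) ->
  exists B, is_resolvent (op_pow T N) mu B /\ op_norm B <= K.
Proof.
destruct N as [|N]; [lia|]. intros _ Hmu HK0 HK.
destruct (roots_of_unit N mu Hmu) as [nu [Hnu Hsum]].
assert (Hnu1 : forall l, unit_circle (nu l)).
{ intros l. pose proof (f_equal Cmod (Hnu l)) as H.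
  rewrite Cmod_pow, Hmu in H. destruct (pow_R1 _ _ H) as [H'|H']; [|lia].
  now rewrite Rabs_pos_eq in H' by apply Cmod_ge_0. }
assert (HR : forall l, exists B, is_resolvent T (nu l) B /\ op_norm B <= K) by auto.
pose (Rs := fun l => proj1_sig (constructive_indefinite_description _ (HR l))).
assert (HRl : forall l, is_resolvent T (nu l) (Rs l) /\ op_norm (Rs l) <= K)
  by (intros l; exact (proj2_sig (constructive_indefinite_description _ (HR l)))).
clearbody Rs. clear HR.
assert (HN : 0 < INR (S N)) by (apply lt_0_INR; lia).
assert (Hmu0 : mu <> 0%C) by (apply Cmod_gt_0; rewrite Hmu; lra).
assert (HN0 : RtoC (INR (S N)) <> 0%C) by (intros H; apply RtoC_inj in H; lra).
pose (c := (/ (RtoC (INR (S N)) * mu))%C).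
pose (B := fun x => scal c (sum_n (fun l => scal (nu l) (Rs l x)) N)).
assert (Hlin : forall l, is_linear (fun x => scal (nu l) (Rs l x))).
{ intros l. apply (is_linear_comp (Rs l) (fun x => scal (nu l) x)).
  - apply HRl.
  - apply is_linear_scal_C. }
assert (HB : is_linear B).
{ apply (is_linear_comp (fun x => sum_n (fun l => scal (nu l) (Rs l x)) N) (fun x => scal c x)).
  - now apply is_linear_sum_n.
  - apply is_linear_scal_C. }
assert (Hc : forall x, scal c (sum_n (fun l => scal (nu l) (diff_quot T (nu l) (S N) x)) N) = x).
{ intros x. rewrite (sum_diff_quot N mu nu Hnu Hsum).
  etransitivity; [exact (scal_assoc c _ x)|].
  transitivity (scal (RtoC 1) x); [|exact (scal_one x)]. f_equal.
  change (c * (RtoC (INR (S N)) * mu) = 1)%C. unfold c. now field. }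
exists B. split; [split; [exact HB|split]|].
- intros x. etransitivity; [|exact (Hc x)]. unfold B. f_equal. apply sum_n_ext. intros l.
  f_equal. destruct (HRl l) as [[_ [H1 _]] _].
  rewrite <- (Hnu l), <- diff_quot_factor by exact HT. apply H1.
- intros x.
  assert (HA : is_linear (fun y => minus (scal mu y) (op_pow T (S N) y))).
  { apply is_linear_minus_op; [apply is_linear_scal_C|now apply is_linear_op_pow]. }
  transitivity (scal c (minus (scal mu (sum_n (fun l => scal (nu l) (Rs l x)) N))
    (op_pow T (S N) (sum_n (fun l => scal (nu l) (Rs l x)) N)))).
  { exact (linear_scal _ HA c _). }
  rewrite (linear_sum_n (fun y => minus (scal mu y) (op_pow T (S N) y))) by exact HA.
  etransitivity; [|exact (Hc x)]. f_equal. apply sum_n_ext. intros l.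
  etransitivity; [exact (linear_scal _ HA (nu l) _)|]. f_equal.
  destruct (HRl l) as [[_ [_ H2]] _].
  transitivity (diff_quot T (nu l) (S N) (minus (scal (nu l) (Rs l x)) (T (Rs l x)))).
  + now rewrite diff_quot_factor_r, Hnu.
  + now rewrite H2.
- apply op_norm_le; [exact HB|exact HK0|]. intros x. unfold B. rewrite norm_scal_C.
  assert (Hs : norm (sum_n (fun l => scal (nu l) (Rs l x)) N) <= INR (S N) * (K * norm x)).
  { eapply Rle_trans; [exact (norm_sum_n_m (fun l => scal (nu l) (Rs l x)) 0 N)|].
    rewrite <- sum_n_const. apply sum_n_m_le. intros l.
    rewrite norm_scal_C, Hnu1, Rmult_1_l.
    eapply Rle_trans; [apply (op_norm_ub (Rs l) x), HRl|].
    apply Rmult_le_compat_r; [apply norm_ge_0|apply HRl]. }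
  unfold c. rewrite Cmod_inv, Cmod_mult, Hmu, Cmod_R, Rabs_pos_eq, Rmult_1_r
    by (lra || now apply Cmult_neq_0).
  apply Rmult_le_compat_l with (r := / INR (S N)) in Hs.
  + rewrite <- Rmult_assoc, Rinv_l, Rmult_1_l in Hs; lra.
  + apply Rlt_le, Rinv_0_lt_compat, HN.
Qed.

End PowerResolvent.

(** * Orders of roots of unity *)

Lemma least_nat (P : nat -> Prop) : (exists n, P n) ->
  exists n, P n /\ forall m, P m -> (n <= m)%nat.
Proof.
intros H.
destruct (Wf_nat.dec_inh_nat_subset_has_unique_least_element P) as [n [Hn _]];
  [intros n; apply classic|exact H|]. now exists n.
Qed.

Lemma root_of_unity_order (z : C) : root_of_unity z -> exists m, is_order z m.
Proof.
intros Hz. destruct (least_nat _ Hz) as [m [[Hm Hzm] Hleast]].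
exists m. split; [exact Hm|]. split; [exact Hzm|].
intros k Hk Hzk. specialize (Hleast k (conj (proj1 Hk) Hzk)). lia.
Qed.

Lemma order_divides (z : C) (m k : nat) :
  is_order z m -> (z ^ k)%C = 1%C -> Nat.divide m k.
Proof.
intros [Hm [Hzm Hmin]] Hk. apply Nat.mod_divide; [lia|].
destruct (Nat.eq_dec (k mod m) 0) as [H|H]; [exact H|exfalso].
apply (Hmin (k mod m)).
- pose proof (Nat.mod_upper_bound k m). lia.
- rewrite (Nat.div_mod_eq k m), Cpow_add_r, Cpow_mult_r, Hzm, Cpow_1_l in Hk.
  now rewrite Cmult_1_l in Hk.
Qed.

Lemma common_exponent (L : list C) : (forall z, In z L -> root_of_unity z) ->
  exists K, (1 <= K)%nat /\ forall z, In z L -> (z ^ K)%C = 1%C.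
Proof.
induction L as [|z L IH]; intros HL.
- exists 1%nat. split; [lia|]. intros z [].
- destruct IH as [K [HK HKL]]; [intros u Hu; apply HL; now right|].
  destruct (HL z) as [m [Hm Hzm]]; [now left|].
  exists (m * K)%nat. split; [nia|]. intros u [<-|Hu].
  + now rewrite Cpow_mult_r, Hzm, Cpow_1_l.
  + now rewrite Nat.mul_comm, Cpow_mult_r, (HKL u Hu), Cpow_1_l.
Qed.

Lemma lcm_of_orders (E : C -> Prop) :
  finite_set E -> (forall z, E z -> root_of_unity z) ->
  exists N, is_lcm (fun m => exists z, E z /\ is_order z m) N /\
    forall z, E z -> (z ^ N)%C = 1%C.
Proof.
intros [L HL] HE.
destruct (common_exponent L) as [K [HK HKL]]; [intros z Hz; now apply HE, HL|].
destruct (least_nat (fun N => (1 <= N)%nat /\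
  forall m, (exists z, E z /\ is_order z m) -> Nat.divide m N)) as [N [[HN HNd] Hmin]].
- exists K. split; [exact HK|]. intros m [z [Hz Hzm]].
  apply (order_divides z); [exact Hzm|]. now apply HKL, HL.
- exists N. split.
  + split; [exact HN|]. split; [exact HNd|]. intros M HM HMd. now apply Hmin.
  + intros z Hz. destruct (root_of_unity_order z (HE z Hz)) as [m Hm].
    destruct (HNd m) as [j ->]; [eauto|].
    now rewrite Nat.mul_comm, Cpow_mult_r, (proj1 (proj2 Hm)), Cpow_1_l.
Qed.

Lemma dist_set_le (z u : C) (E : C -> Prop) : E u -> dist_set z E <= Cmod (z - u)%C.
Proof.
intros Hu. unfold dist_set.
pose proof (Glb_Rbar_correct (fun r => exists u : C, E u /\ r = Cmod (z - u)%C)) as [Hlb Hg].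
assert (H : Rbar_le (Glb_Rbar (fun r => exists u : C, E u /\ r = Cmod (z - u)%C))
  (Cmod (z - u)%C)) by (apply Hlb; eauto).
destruct (Glb_Rbar _) as [l| |]; simpl in *; [exact H|contradiction|].
apply Cmod_ge_0.
Qed.

(** * Resolvent bounds near the exceptional set *)

Section Estimates.
Context {Y : CompleteNormedModule C_AbsRing}.
Local Notation X := (CompleteNormedModule.NormedModule C_AbsRing Y).
Context (T : X -> X) (M : R) (w : A11) (q : R).
Hypothesis (HT : is_linear T) (HM0 : 0 <= M)
  (HM : forall n, bounded_by (op_pow T n) M)
  (Hw : forall n, (1 <= n)%nat -> op_norm (A11_op w (op_pow T n)) <= q)
  (Hq : q < A11_norm_infty w).

Lemma exists_large_value : exists z0, unit_circle z0 /\ q < Cmod (A11_eval w z0).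
Proof.
apply A11_norm_attained; [|exact Hq].
eapply Rle_trans; [|apply (Hw 1 (le_n 1))].
apply op_norm_ge_0. apply (@A11_op_correct Y).
- now apply is_linear_op_pow.
- now apply power_bounded_op_pow with M.
Qed.

(** The exponent [n] of [E_set_escape] bounds the resolvent by a multiple of
    [n]. The alternative [op_norm B <= K] keeps a uniform bound when [E] is
    empty, where there is no distance to divide by. *)
Lemma resolvent_circle_bound : exists K, 0 <= K /\
  forall mu, unit_circle mu -> ~ E_set w q mu ->
  exists B, is_resolvent T mu B /\
    (op_norm B <= K \/ exists u, E_set w q u /\ op_norm B * Cmod (mu - u)%C <= K).
Proof.
destruct exists_large_value as [z0 [Hz0 Hz0q]].
destruct (E_set_escape w q z0 Hz0 Hz0q) as [C0 [d [Hd Hesc]]].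
pose proof (A11_norm_ge_0 w) as HS.
assert (Hc : 0 <= M * A11_norm w / d).
{ apply Rmult_le_pos; [now apply Rmult_le_pos|]. now apply Rlt_le, Rinv_0_lt_compat. }
pose proof (Rmax_l C0 0) as Hl. pose proof (Rmax_r C0 0) as Hr.
exists (Rmax C0 0 * (M * A11_norm w / d)). split; [now apply Rmult_le_pos|].
intros mu Hmu HmuE. destruct (Hesc mu Hmu HmuE) as [n [Hn [Hnw Hdist]]].
destruct (resolvent_on_circle T M w q d mu n HT HM0 HM (Hw n Hn) Hmu Hd Hnw)
  as [B [HB HBb]].
assert (Hnorm : op_norm B <= INR n * (M * A11_norm w / d)).
{ apply op_norm_le; [apply HB| |exact HBb]. apply Rmult_le_pos; [apply pos_INR|exact Hc]. }
exists B. split; [exact HB|].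
destruct Hdist as [HnC|[u [Hu HnC]]]; [left|right; exists u; split; [exact Hu|]].
- eapply Rle_trans; [exact Hnorm|]. apply Rmult_le_compat_r; lra.
- apply Rle_trans with (INR n * Cmod (mu - u)%C * (M * A11_norm w / d)).
  + pose proof (Cmod_ge_0 (mu - u)%C).
    replace (INR n * Cmod (mu - u)%C * (M * A11_norm w / d))
      with (INR n * (M * A11_norm w / d) * Cmod (mu - u)%C) by ring.
    now apply Rmult_le_compat_r.
  + apply Rmult_le_compat_r; lra.
Qed.

Lemma Cmod_minus_circle_le (a b : C) :
  unit_circle a -> unit_circle b -> Cmod (a - b)%C <= 2.
Proof.
intros Ha Hb. eapply Rle_trans; [apply (Cmod_triangle a (- b)%C)|].
rewrite Cmod_opp, Ha, Hb. lra.
Qed.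

Lemma E_set_Ritt_on : (exists z, E_set w q z) -> is_Ritt_on (E_set w q) T.
Proof.
intros [z Hz]. destruct exists_large_value as [z0 [Hz0 Hz0q]].
destruct resolvent_circle_bound as [K [HK0 HK]].
split; [now apply (E_set_finite w q z0)|]. split; [eauto|].
split; [intros u Hu; apply Hu|].
split; [intros u Hu; exact (spectrum_in_disc T M HT HM u Hu)|].
exists (M + (1 + M) * (2 * K)). intros x B Hx HB.
destruct (ritt_from_circle T M HT HM0 HM (E_set w q) (2 * K)) with (3 := Hx) (4 := HB)
  as [u [Hu Hb]]; [lra| |].
- intros mu Hmu. destruct (classic (E_set w q mu)) as [HE|HE]; [now left|right].
  destruct (HK mu Hmu HE) as [B0 [HB0 Hcase]]. exists B0. split; [exact HB0|].
  pose proof (op_norm_ge_0 B0 (proj1 HB0)) as Hn0.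
  destruct Hcase as [H|[u [Hu H]]].
  + exists z. split; [exact Hz|].
    pose proof (Cmod_minus_circle_le mu z Hmu (proj1 Hz)).
    pose proof (Cmod_ge_0 (mu - z)%C). nra.
  + exists u. split; [exact Hu|lra].
- eapply Rle_trans; [|exact Hb].
  apply Rmult_le_compat_r; [apply op_norm_ge_0, HB|]. now apply dist_set_le.
Qed.

(** For [|mu| = 1], an [N]-th root [nu] of [mu <> 1] is outside [E], and
    [|mu - 1| = |nu ^ N - u ^ N| <= N |nu - u|] for [u] in [E]. *)
Lemma op_pow_Ritt (N : nat) : (1 <= N)%nat ->
  (forall u, E_set w q u -> (u ^ N)%C = 1%C) -> is_Ritt (op_pow T N).
Proof.
intros HN HE. destruct resolvent_circle_bound as [K [HK0 HK]].
assert (HTN : is_linear (op_pow T N)) by now apply is_linear_op_pow.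
assert (HMN : forall n, bounded_by (op_pow (op_pow T N) n) M).
{ intros n x. rewrite op_pow_mult. apply HM. }
split; [intros z Hz; exact (spectrum_in_disc (op_pow T N) M HTN HMN z Hz)|].
set (K' := (2 + INR N) * K).
assert (HK' : 0 <= K') by (apply Rmult_le_pos; [pose proof (pos_INR N)|]; lra).
exists (M + (1 + M) * K'). intros z B Hz HB.
destruct (ritt_from_circle (op_pow T N) M HTN HM0 HMN (fun u => u = RtoC 1) K')
  with (3 := Hz) (4 := HB) as [u [-> Hb]]; [exact HK'| |exact Hb].
intros mu Hmu. destruct (classic (mu = RtoC 1)) as [H1|H1]; [now left|right].
assert (Hm1 : 0 < Cmod (mu - 1)%C).
{ apply Cmod_gt_0. intros H. apply H1.
  replace mu with ((mu - 1) + 1)%C by ring. rewrite H. ring. }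
destruct (resolvent_op_pow T HT N mu (K' / Cmod (mu - 1)%C) HN Hmu) as [B0 [HB0 HB0n]].
- apply Rmult_le_pos; [exact HK'|]. now apply Rlt_le, Rinv_0_lt_compat.
- intros nu Hnu Hnumu.
  destruct (HK nu Hnu) as [B1 [HB1 Hcase]]; [intros H; apply H1; rewrite <- Hnumu; auto|].
  exists B1. split; [exact HB1|]. apply Rle_div_r; [exact Hm1|].
  pose proof (op_norm_ge_0 B1 (proj1 HB1)) as Hn0. pose proof (pos_INR N) as HN0.
  unfold K'. destruct Hcase as [H|[u [Hu H]]].
  + pose proof (Cmod_minus_circle_le mu 1%C Hmu Cmod_1). nra.
  + assert (Hd : Cmod (mu - 1)%C <= INR N * Cmod (nu - u)%C).
    { rewrite <- Hnumu, <- (HE u Hu). apply Cmod_pow_minus_le; [exact Hnu|apply Hu]. }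
    apply Rle_trans with (INR N * (op_norm B1 * Cmod (nu - u)%C)); nra.
- exists B0. split; [exact HB0|]. exists (RtoC 1). split; [reflexivity|].
  apply Rle_div_r in HB0n; [exact HB0n|exact Hm1].
Qed.

End Estimates.

Theorem theorem4p10 (X : CompleteNormedModule C_AbsRing) (T : X -> X)
    (w : A11) (q : R)
    (hT : is_linear T) (hpb : power_bounded T)
    (hw : forall n : nat, (1 <= n)%nat -> op_norm (A11_op w (op_pow T n)) <= q)
    (hq : q < A11_norm_infty w) :
  finite_set (E_set w q) /\
  (forall z : C, E_set w q z -> root_of_unity z) /\
  (forall z : C, spectrum T z -> unit_circle z -> E_set w q z) /\
  ((forall z : C, ~ E_set w q z) -> spectral_radius T < 1) /\
  ((exists z : C, E_set w q z) ->
    E_set w q (RtoC 1) /\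
    (exists N : nat,
      is_lcm (fun m : nat => exists z : C, E_set w q z /\ is_order z m) N /\
      is_Ritt (op_pow T N)) /\
    is_Ritt_on (E_set w q) T).
Proof.
destruct (power_bounded_by T hT hpb) as [M [HM0 HM]].
destruct (exists_large_value T M w q hT HM0 HM hw hq) as [z0 [Hz0 Hz0q]].
destruct (E_set_finite w q z0 Hz0 Hz0q) as [Hfin Hroot].
destruct (resolvent_circle_bound T M w q hT HM0 HM hw hq) as [K [HK0 HK]].
split; [exact Hfin|]. split; [exact Hroot|]. split; [|split].
- intros z Hz Hz1. apply NNPP. intros HE. apply Hz.
  destruct (HK z Hz1 HE) as [B [HB _]]. eauto.
- intros Hempty. apply (spectral_radius_lt_1 T M hT HM K HK0).
  intros mu Hmu. destruct (HK mu Hmu (Hempty mu)) as [B [HB [H|[u [Hu _]]]]].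
  + eauto.
  + destruct (Hempty u Hu).
- intros [z Hz]. split; [|split].
  + split; [exact Cmod_1|]. intros n _. rewrite Cpow_1_l.
    destruct (Hroot z Hz) as [m [Hm Hzm]]. rewrite <- Hzm. now apply Hz.
  + destruct (lcm_of_orders _ Hfin Hroot) as [N [HN HN1]].
    exists N. split; [exact HN|].
    exact (op_pow_Ritt T M w q hT HM0 HM hw hq N (proj1 HN) HN1).
  + apply (E_set_Ritt_on T M w q hT HM0 HM hw hq). now exists z.
Qed.
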